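(* Let $(A,\rho)\in\mathbb{R}^{m\times n}\times[0,1)$ be given and let $w_\star(b,\lambda)$ be the minimum $\ell_2$-norm extended solution of the sGMC model, as a function of $(b,\lambda)\in\mathbb{R}^{2m}\times\mathbb{R}_{++}$. Then: (a) $w_\star(b,\lambda)$ is piecewise linear in $(b,\lambda)\in\mathbb{R}^{2m}\times\mathbb{R}_{++}$ with finitely many (at most $3^{2n}$) linear zones, and $\mathrm{sign}(w_\star(b,\lambda))$ is constant within the interior of each linear zone. (b) The correspondence between a linear zone of $w_\star(\cdot,\cdot)$ and its zone indicator $s$ is one-to-one. Moreover, if $s$ is a zone indicator and $I(s)\subset\mathbb{R}^{2m}\times\mathbb{R}_{++}$ is its linear zone, then $I(s)$ is a convex cone contained in $\hat I_{EN}(s)$ and $$w_\star(b,\lambda)=\hat w_{EQ}(s;b,\lambda)\qquad\text{for all }(b,\lambda)\in I(s).$$ (c) If $A$ has columns in general position, then for every zone indicator $s$ one has $I(s)=\hat I_{EN}(s)$, and for all $(b,\lambda)\in I(s)$, $$w_\star(b,\lambda)=\hat w_{EQ}(s;b,\lambda),\qquad S_e(b,\lambda)=\hat S_{EQ\text{-}NQ}(s;b,\lambda).$$ Moreover, for every $(b,\lambda)\in\mathrm{int}(\hat I_{EN}(s))$, $$s=\mathrm{sign}(w_\star(b,\lambda))=\mathrm{csign}(b,\lambda).$$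
   Context: Here $\mathbb{R}_{++}=(0,\infty)$, $m,n$ are positive integers, and $b=(y^\top,r^\top)^\top$ with $y,r\in\mathbb{R}^m$. The sGMC model. For $x,z\in\mathbb{R}^n$ let $$G(x,z)=\tfrac12\|y-Ax\|_2^2+\lambda\|x\|_1-\lambda\|z\|_1-\tfrac{\rho}{2}\|Ax-Az\|_2^2+\sqrt{\rho}\,r^\top Az .$$ The extended solution set $S_e(b,\lambda)\subset\mathbb{R}^{2n}$ is the set of $w=(x^\top,z^\top)^\top$ with $G(x,z')\le G(x,z)\le G(x',z)$ for all $x',z'\in\mathbb{R}^n$; it is nonempty, closed, convex and bounded, and $w_\star(b,\lambda)$ denotes its unique element of minimum $\ell_2$-norm. Matrices. $C=\mathrm{blkdiag}(A,\sqrt{\rho}A)\in\mathbb{R}^{2m\times 2n}$ with columns $c_1,\dots,c_{2n}$, and $D=\begin{bmatrix}(1-\rho)I_m&\sqrt{\rho}I_m\\-\sqrt{\rho}I_m&I_m\end{bmatrix}$. For an index set $E$, $C_E$ is the submatrix of columns indexed by $E$, $[w]_E$ the subvector, $\neg E=\{1,\dots,2n\}\setminus E$. $\mathrm{sign}(w)\in\{+1,0,-1\}^{2n}$ is taken componentwise, $\mathrm{supp}$ is the set of indices of nonzero components. Equicorrelation signs. For $w\in S_e(b,\lambda)$ put $\xi_i=c_i^\top(b-DCw)$ (independent of the choice of $w\in S_e(b,\lambda)$, since $Cw$ is). $\mathrm{csign}(b,\lambda)\in\{+1,0,-1\}^{2n}$ has $i$th component $\mathrm{sign}(\xi_i)$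 if $|\xi_i|=\lambda$, and $0$ otherwise. Candidate objects. For $s\in\{+1,0,-1\}^{2n}$ and $E=\mathrm{supp}(s)$, consider the conditions on $w\in\mathbb{R}^{2n}$: (EQ) $c_i^\top(b-DCw)=\lambda[s]_i$ for $i\in E$, and $[w]_i=0$ for $i\in\neg E$; (NQ) $[s]_i[w]_i\ge0$ for $i\in E$, and $|c_i^\top(b-DCw)|\le\lambda$ for $i\in\neg E$. - $\hat w_{EQ}(s;b,\lambda)$ is the (minimum-norm) least-squares fit of (EQ): $[\hat w_{EQ}]_{\neg E}=0$ and $[\hat w_{EQ}]_E=(C_E^\top DC_E)^\dagger(C_E^\top b-\lambda[s]_E)$, with $\dagger$ the Moore–Penrose pseudoinverse ($\hat w_{EQ}=0$ if $E=\emptyset$). - $\hat S_{EQ\text{-}NQ}(s;b,\lambda)$ is the set of $w\in\mathbb{R}^{2n}$ satisfying both (EQ) and (NQ). - $\hat I_{EN}(s)$ is the set of $(b,\lambda)\in\mathbb{R}^{2m}\times\mathbb{R}_{++}$ with $\hat w_{EQ}(s;b,\lambda)\in\hat S_{EQ\text{-}NQ}(s;b,\lambda)$. Linear zones. A linear zone of $w_\star(\cdot,\cdot)$ is the closure, relative to $\mathbb{R}^{2m}\times\mathbb{R}_{++}$, of a connected component of the open set of points having a neighbourhood on which $w_\star$ coincides with a linear function of $(b,\lambda)$; ''piecewise linear with finitely many linear zones'' means that there are finitely many linear zones, they cover $\mathbb{R}^{2m}\times\mathbb{R}_{++}$, and on each of them $w_\star$ coincides with a linear function. A vector $s\in\{+1,0,-1\}^{2n}$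 is a zone indicator (the indicator of a given linear zone) if $s=\mathrm{sign}(w_\star(b,\lambda))$ for all $(b,\lambda)$ in the interior of that linear zone. A convex cone here is a set closed under linear combinations with nonnegative coefficients that are not all zero. General position. $A=[a_1,\dots,a_n]$ has columns in general position if for every $I\subset\{1,\dots,n\}$ with $|I|\le m$, every $i\in\{1,\dots,n\}\setminus I$, and all signs $(s_j)_{j\in I\cup\{i\}}\subset\{+1,-1\}$, one has $s_ia_i\notin\mathrm{aff}\{s_ja_j\}_{j\in I}$ (affine hull; $\mathrm{aff}\,\emptyset=\emptyset$). *)

(* Defs.v *)
From HB Require Import structures.
From mathcomp Require Import all_boot all_order all_algebra.
From mathcomp Require Import all_classical all_reals all_analysis.

Set Implicit Arguments.
Unset Strict Implicit.
Unset Printing Implicit Defensive.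

Import Order.TTheory GRing.Theory Num.Theory.
Import numFieldNormedType.Exports.

Local Open Scope classical_set_scope.
Local Open Scope ring_scope.

(* The library norm on matrices is the sup norm, hence these two. *)
Definition l1norm (R : realType) (k : nat) (v : 'cV[R]_k) : R :=
  \sum_i `|v i ord0|.

Definition l2norm (R : realType) (k : nat) (v : 'cV[R]_k) : R :=
  Num.sqrt (\sum_i v i ord0 ^+ 2).

(* b stacks y over r, and w stacks x over z. *)
Definition sGMC_obj (R : realType) (m n : nat) (A : 'M[R]_(m, n)) (rho : R)
    (b : 'cV[R]_(m + m)) (lam : R) (x z : 'cV[R]_n) : R :=
  let y := usubmx b in let r := dsubmx b in
  2^-1 * l2norm (y - A *m x) ^+ 2 + lam * l1norm x - lam * l1norm z
  - rho / 2 * l2norm (A *m x - A *m z) ^+ 2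
  + Num.sqrt rho * (r^T *m (A *m z)) ord0 ord0.

Definition ext_sol (R : realType) (m n : nat) (A : 'M[R]_(m, n)) (rho : R)
    (b : 'cV[R]_(m + m)) (lam : R) : set 'cV[R]_(n + n) :=
  [set w | forall x' z' : 'cV[R]_n,
     sGMC_obj A rho b lam (usubmx w) z'
       <= sGMC_obj A rho b lam (usubmx w) (dsubmx w)
       <= sGMC_obj A rho b lam x' (dsubmx w)].

Definition is_min_norm (R : realType) (k : nat) (S : set 'cV[R]_k)
    (w : 'cV[R]_k) : Prop :=
  S w /\ forall w', S w' -> l2norm w <= l2norm w'.

(* The parameter (b, lam) is a point of the product 'cV_(m + m) * R; the
   default value 0 is only reached if no minimizer exists, which does not
   happen when 0 <= rho < 1 and 0 < lam. *)
Definition wstar (R : realType) (m n : nat) (A : 'M[R]_(m, n)) (rho : R)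
    (p : 'cV[R]_(m + m) * R) : 'cV[R]_(n + n) :=
  xget 0 [set w | is_min_norm (ext_sol A rho p.1 p.2) w].

Definition Cmx (R : realType) (m n : nat) (A : 'M[R]_(m, n)) (rho : R)
    : 'M[R]_(m + m, n + n) :=
  block_mx A 0 0 (Num.sqrt rho *: A).

Definition Dmx (R : realType) (m : nat) (rho : R) : 'M[R]_(m + m) :=
  block_mx (1 - rho)%:M (Num.sqrt rho)%:M (- Num.sqrt rho)%:M 1%:M.

(* The i-th entry is c_i^T (b - D C w). *)
Definition xi (R : realType) (m n : nat) (A : 'M[R]_(m, n)) (rho : R)
    (b : 'cV[R]_(m + m)) (w : 'cV[R]_(n + n)) : 'cV[R]_(n + n) :=
  (Cmx A rho)^T *m (b - Dmx m rho *m Cmx A rho *m w).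

(* Elements of {+1, 0, -1}^k, as real column vectors. *)
Definition sign_vector (R : realType) (k : nat) (s : 'cV[R]_k) : Prop :=
  forall i, [\/ s i ord0 = 1, s i ord0 = 0 | s i ord0 = -1].

Definition signv (R : realType) (k : nat) (w : 'cV[R]_k) : 'cV[R]_k :=
  map_mx Num.sg w.

Definition supp (R : realType) (k : nat) (w : 'cV[R]_k) : {set 'I_k} :=
  [set i | w i ord0 != 0]%SET.

(* Any element of the extended solution set may be used here, since C w is
   the same for all of them. *)
Definition csign (R : realType) (m n : nat) (A : 'M[R]_(m, n)) (rho : R)
    (p : 'cV[R]_(m + m) * R) : 'cV[R]_(n + n) :=
  let v := xi A rho p.1 (xget 0 (ext_sol A rho p.1 p.2)) in
  \col_i (if `|v i ord0| == p.2 then Num.sg (v i ord0) else 0).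

Definition sat_EQ (R : realType) (m n : nat) (A : 'M[R]_(m, n)) (rho : R)
    (s : 'cV[R]_(n + n)) (p : 'cV[R]_(m + m) * R) (w : 'cV[R]_(n + n)) : Prop :=
  (forall i, i \in supp s -> xi A rho p.1 w i ord0 = p.2 * s i ord0) /\
  (forall i, i \notin supp s -> w i ord0 = 0).

Definition sat_NQ (R : realType) (m n : nat) (A : 'M[R]_(m, n)) (rho : R)
    (s : 'cV[R]_(n + n)) (p : 'cV[R]_(m + m) * R) (w : 'cV[R]_(n + n)) : Prop :=
  (forall i, i \in supp s -> 0 <= s i ord0 * w i ord0) /\
  (forall i, i \notin supp s -> `|xi A rho p.1 w i ord0| <= p.2).

Definition S_EQNQ (R : realType) (m n : nat) (A : 'M[R]_(m, n)) (rho : R)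
    (s : 'cV[R]_(n + n)) (p : 'cV[R]_(m + m) * R) : set 'cV[R]_(n + n) :=
  [set w | sat_EQ A rho s p w /\ sat_NQ A rho s p w].

(* The Penrose equations.  The library's pinvmx is only some generalized
   inverse, not the Moore-Penrose one. *)
Definition is_MoorePenrose (R : realType) (k l : nat) (M : 'M[R]_(k, l))
    (X : 'M[R]_(l, k)) : Prop :=
  [/\ M *m X *m M = M, X *m M *m X = X,
      (M *m X)^T = M *m X & (X *m M)^T = X *m M].

Definition MoorePenrose (R : realType) (k l : nat) (M : 'M[R]_(k, l))
    : 'M[R]_(l, k) :=
  xget 0 [set X | is_MoorePenrose M X].

Definition colsE (R : realType) (k l : nat) (M : 'M[R]_(k, l)) (E : {set 'I_l})
    : 'M[R]_(k, #|E|) :=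
  colsub (fun j : 'I_#|E| => enum_val j) M.

Definition subvec (R : realType) (k : nat) (w : 'cV[R]_k) (E : {set 'I_k})
    : 'cV[R]_#|E| :=
  rowsub (fun j : 'I_#|E| => enum_val j) w.

(* The vector with subvector v on E and zeros outside E: the j-th column of
   colsE 1%:M E is the canonical basis vector indexed by the j-th element
   of E. *)
Definition extend0 (R : realType) (k : nat) (E : {set 'I_k}) (v : 'cV[R]_#|E|)
    : 'cV[R]_k :=
  colsE 1%:M E *m v.

Definition w_EQ (R : realType) (m n : nat) (A : 'M[R]_(m, n)) (rho : R)
    (s : 'cV[R]_(n + n)) (p : 'cV[R]_(m + m) * R) : 'cV[R]_(n + n) :=
  let E := supp s in
  let CE := colsE (Cmx A rho) E in
  extend0 (MoorePenrose (CE^T *m Dmx m rho *m CE)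
             *m (CE^T *m p.1 - p.2 *: subvec s E)).

Definition param_dom (R : realType) (k : nat) : set ('cV[R]_k * R) :=
  [set p | 0 < p.2].

Definition I_EN (R : realType) (m n : nat) (A : 'M[R]_(m, n)) (rho : R)
    (s : 'cV[R]_(n + n)) : set ('cV[R]_(m + m) * R) :=
  [set p | param_dom p /\ S_EQNQ A rho s p (w_EQ A rho s p)].

Definition coincides_linear (R : realType) (k l : nat)
    (f : 'cV[R]_k * R -> 'cV[R]_l) (Z : set ('cV[R]_k * R)) : Prop :=
  exists L : {linear ('cV[R]_k * R)%type -> 'cV[R]_l}, forall p, Z p -> f p = L p.

Definition locally_linear_pts (R : realType) (k l : nat)
    (f : 'cV[R]_k * R -> 'cV[R]_l) : set ('cV[R]_k * R) :=
  [set p | exists U, [/\ nbhs p U, U `<=` @param_dom R k & coincides_linear f U]].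

(* The domain is open, so the interior of a zone relative to the domain is its
   interior in the whole space. *)
Definition linear_zones (R : realType) (k l : nat)
    (f : 'cV[R]_k * R -> 'cV[R]_l) : set (set ('cV[R]_k * R)) :=
  [set Z | exists2 p, locally_linear_pts f p &
     Z = closure (connected_component (locally_linear_pts f) p)
           `&` @param_dom R k].

Definition piecewise_linear (R : realType) (k l : nat)
    (f : 'cV[R]_k * R -> 'cV[R]_l) : Prop :=
  [/\ finite_set (linear_zones f),
      \bigcup_(Z in linear_zones f) Z = @param_dom R k &
      forall Z, linear_zones f Z -> coincides_linear f Z].

Definition zone_indicator (R : realType) (k l : nat)
    (f : 'cV[R]_k * R -> 'cV[R]_l) (Z : set ('cV[R]_k * R)) (s : 'cV[R]_l)
    : Prop :=
  sign_vector s /\ forall p, interior Z p -> s = signv (f p).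

Definition convex_cone (R : realType) (V : lmodType R) (K : set V) : Prop :=
  forall (k : nat) (c : 'I_k -> R) (v : 'I_k -> V),
    (forall i, 0 <= c i) -> (exists i, c i != 0) -> (forall i, K (v i)) ->
    K (\sum_i c i *: v i).

(* Affine hull of the family (v j)_(j in I); it is empty when I is. *)
Definition aff (R : realType) (m n : nat) (I : {set 'I_n})
    (v : 'I_n -> 'cV[R]_m) : set 'cV[R]_m :=
  [set u | exists t : 'I_n -> R,
     \sum_(j in I) t j = 1 /\ u = \sum_(j in I) t j *: v j].

Definition general_position (R : realType) (m n : nat) (A : 'M[R]_(m, n))
    : Prop :=
  forall (I : {set 'I_n}) (i : 'I_n) (s : 'I_n -> R),
    (#|I| <= m)%N -> i \notin I ->
    (forall j, j \in (i |: I)%SET -> s j = 1 \/ s j = -1) ->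
    ~ aff I (fun j => s j *: col j A) (s i *: col i A).

(* Main.v *)
Require Import Defs.
From HB Require Import structures.
From mathcomp Require Import all_boot all_order all_algebra.
From mathcomp Require Import all_classical all_reals all_analysis.
From mathcomp Require Import ring lra.
Import Order.TTheory GRing.Theory Num.Theory.
Import numFieldNormedType.Exports.
Local Open Scope classical_set_scope.
Local Open Scope ring_scope.
Set Implicit Arguments.
Unset Strict Implicit.
Unset Printing Implicit Defensive.

(** Write a parameter as [p = (b, lam)]. The objective is convex in [x] and
    concave in [z], and its optimality conditions say that the residual
    [C^T (b - D C w)] is a subgradient of [lam * l1norm] at [w]
    ([ext_sol_kkt]). Since [rho < 1], the matrix [D] has a positive definite
    symmetric part ([Dmx_pos]); this is all that the first two parts of the
    theorem use, and they are proved for an arbitrary matrix [C] and such a [D].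

    Monotonicity of subgradients shows that all solutions at [p] have the same
    image under [C], hence the same residual ([kkt_eqC]). Solutions exist
    because they are the fixed points of a nonexpansive map, soft-thresholding
    after a gradient step ([exists_kkt]), and the solution set is compact and
    convex, so that a unique solution has minimum norm.

    Cut the parameter space into cells according to the sign vector [s] of the
    minimum-norm solution. The tool is the first-order condition
    [min_norm_dir]: the shortest solution [w] satisfies [0 <= dot w h] for all
    feasible directions [h]. Applied to the difference with the least-squares
    fit it identifies the two on the cell of [s] ([cell_eq_fit]), so the solution
    is linear there; applied at two parameters of the same cell it shows that the
    sum of their solutions is the solution for the sum of the parameters, so
    cells are convex cones ([cellD]).

    The linear zones are the closures of the cells with nonempty interior
    ([linear_zonesP]). Where the solution is locally linear no component can
    change sign, because the corresponding entry of the residual would jump from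
    [- lam] to [lam] ([linear_piece_vanish]); so the set of points of local
    linearity is the disjoint union of the open cells, which are convex and hence
    are its components. The formula of a cell extends to its closure by an
    explicit perturbation towards the interior ([cell_boundary]). The closures
    cover everything: infinitely many points of a moment curve that tends to [p]
    share a cell, which therefore contains a basis and has interior points
    ([open_cells_cover]).

    If [A] is in general position, a vector annihilated by [C] and supported
    where the residual attains [lam] in absolute value is zero ([Cmx_kernel]).
    Hence solutions are unique, and a fit that meets (EQ) and (NQ) is the
    solution; this gives the equality of a zone with the set on which the fit is
    valid ([I_EN_zone]). At an interior point an index off the support cannot
    attain [lam], since by linearity it would do so for all parameters and
    its column would depend on those of the support ([strict_off_support]). *)

(** * Dot products and the Moore-Penrose inverse *)

Definition dot (R : realType) (k : nat) (u v : 'cV[R]_k) : R :=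
  \sum_i u i ord0 * v i ord0.

Section Dot.
Variables (R : realType) (k : nat).
Implicit Types (u v w : 'cV[R]_k) (a : R).

Lemma dotC u v : dot u v = dot v u.
Proof. by apply: eq_bigr => i _; rewrite mulrC. Qed.

Lemma dotDl u v w : dot (u + v) w = dot u w + dot v w.
Proof. by rewrite -big_split; apply: eq_bigr => i _; rewrite mxE mulrDl. Qed.

Lemma dotDr u v w : dot u (v + w) = dot u v + dot u w.
Proof. by rewrite dotC dotDl !(dotC u). Qed.

Lemma dotZl a u v : dot (a *: u) v = a * dot u v.
Proof. by rewrite mulr_sumr; apply: eq_bigr => i _; rewrite mxE mulrA. Qed.

Lemma dotZr a u v : dot u (a *: v) = a * dot u v.
Proof. by rewrite dotC dotZl dotC. Qed.

Lemma dotNl u v : dot (- u) v = - dot u v.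
Proof. by rewrite -scaleN1r dotZl mulN1r. Qed.

Lemma dotNr u v : dot u (- v) = - dot u v.
Proof. by rewrite dotC dotNl dotC. Qed.

Lemma dot0l v : dot 0 v = 0.
Proof. by rewrite -(scale0r 0) dotZl mul0r. Qed.

Lemma dot0r u : dot u 0 = 0.
Proof. by rewrite dotC dot0l. Qed.

Lemma dot_ge0 u : 0 <= dot u u.
Proof. by apply: sumr_ge0 => i _; rewrite -expr2 sqr_ge0. Qed.

Lemma dot_eq0 u : dot u u = 0 -> u = 0.
Proof.
move/eqP; rewrite psumr_eq0 => [/allP u0|i _]; last by rewrite -expr2 sqr_ge0.
apply/colP => i; have := u0 i; rewrite mem_index_enum => /(_ isT) /=.
by rewrite mulf_eq0 orbb mxE => /eqP.
Qed.

Lemma l2normE u : l2norm u = Num.sqrt (dot u u).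
Proof. by congr Num.sqrt; apply: eq_bigr => i _; rewrite expr2. Qed.

Lemma sqr_l2norm u : l2norm u ^+ 2 = dot u u.
Proof. by rewrite l2normE sqr_sqrtr // dot_ge0. Qed.

Lemma ler_l2norm u v : (l2norm u <= l2norm v) = (dot u u <= dot v v).
Proof. by rewrite !l2normE ler_sqrt ?dot_ge0. Qed.

Lemma sqr_coord_le_dot u i : u i ord0 ^+ 2 <= dot u u.
Proof.
rewrite /dot (bigD1 i) //= expr2 lerDl sumr_ge0 // => j _.
by rewrite -expr2 sqr_ge0.
Qed.

Lemma dot_delta u i : dot u (delta_mx i ord0) = u i ord0.
Proof.
rewrite /dot (bigD1 i) //= big1 ?addr0 => [|j ji]; last first.
  by rewrite mxE (negbTE ji) mulr0.
by rewrite mxE !eqxx mulr1.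
Qed.

Lemma cauchy_schwarz u v : dot u v ^+ 2 <= dot u u * dot v v.
Proof.
have [v0|vn0] := eqVneq (dot v v) 0.
  by rewrite (dot_eq0 v0) !dot0r mulr0 expr0n.
have := dot_ge0 (dot v v *: u - dot u v *: v).
rewrite !(dotDl, dotDr, dotNl, dotNr, dotZl, dotZr) (dotC v u) => h.
have vp : 0 < dot v v by rewrite lt_neqAle eq_sym vn0 dot_ge0.
rewrite -subr_ge0 -(pmulr_rge0 _ vp); apply: le_trans h _.
by rewrite le_eqVlt; apply/orP; left; apply/eqP; ring.
Qed.

End Dot.

Lemma dot_trmx (R : realType) (k l : nat) (M : 'M[R]_(k, l)) u v :
  dot (M^T *m u) v = dot u (M *m v).
Proof.
rewrite /dot; under eq_bigr => i _ do rewrite mxE mulr_suml.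
rewrite exchange_big /=; apply: eq_bigr => j _; rewrite mxE mulr_sumr.
by apply: eq_bigr => i _; rewrite mxE mulrCA mulrA.
Qed.

Lemma dot_trmxr (R : realType) (k l : nat) (M : 'M[R]_(k, l)) u v :
  dot v (M^T *m u) = dot (M *m v) u.
Proof. by rewrite dotC dot_trmx dotC. Qed.

Lemma dot_col_mx (R : realType) (k l : nat) (u1 v1 : 'cV[R]_k)
    (u2 v2 : 'cV[R]_l) :
  dot (col_mx u1 u2) (col_mx v1 v2) = dot u1 v1 + dot u2 v2.
Proof.
rewrite /dot big_split_ord /=; congr (_ + _); apply: eq_bigr => i _.
  by rewrite !col_mxEu.
by rewrite !col_mxEd.
Qed.

Lemma mulmx_bounded (R : realType) (k l : nat) (M : 'M[R]_(k, l)) :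
  exists2 K : R, 0 < K & forall v, dot (M *m v) (M *m v) <= K * dot v v.
Proof.
pose r i : 'cV[R]_l := (row i M)^T.
exists (1 + \sum_i dot (r i) (r i)).
  by rewrite ltr_pwDl // sumr_ge0 // => i _; exact: dot_ge0.
move=> v; rewrite mulrDl mul1r mulr_suml ler_wpDl ?dot_ge0 //.
apply: ler_sum => i _; rewrite -expr2.
suff -> : (M *m v) i ord0 = dot (r i) v by exact: cauchy_schwarz.
by rewrite mxE; apply: eq_bigr => j _; rewrite !mxE.
Qed.

(** Over the reals [B^T *m B *m v = 0] forces [dot (B *m v) (B *m v) = 0]. Both
    factors of a rank factorization can therefore be inverted on one side,
    which is what the usual formula for the pseudoinverse needs. *)
Lemma gram_unitmx (R : realType) (k l : nat) (B : 'M[R]_(k, l)) :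
  \rank B = l -> B^T *m B \in unitmx.
Proof.
move=> rB; rewrite -unitmx_tr -row_free_unit -kermx_eq0; apply/eqP/row_matrixP => i.
rewrite row0; set r := row i _.
have : r *m (B^T *m B)^T = 0.
  by apply/sub_kermxP; exact: row_sub.
rewrite trmx_mul trmxK => rBB.
have /dot_eq0 Br : dot (B *m r^T) (B *m r^T) = 0.
  rewrite -dot_trmx (_ : B^T *m _ = 0) ?dot0l //; apply: trmx_inj.
  by rewrite !trmx_mul !trmxK -mulmxA rBB trmx0.
have : r *m B^T = 0 by rewrite -(trmxK (r *m _)) trmx_mul trmxK Br trmx0.
have fB : row_free B^T by rewrite /row_free mxrank_tr rB.
by move/(congr1 (fun X => X *m pinvmx B^T)); rewrite mulmxKp // mul0mx.
Qed.

Lemma full_rank_product_MoorePenrose (R : realType) (k r l : nat)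
    (B : 'M[R]_(k, r)) (F : 'M[R]_(r, l)) :
  B^T *m B \in unitmx -> F *m F^T \in unitmx ->
  is_MoorePenrose (B *m F)
    (F^T *m invmx (F *m F^T) *m (invmx (B^T *m B) *m B^T)).
Proof.
move=> uB uF.
set Bi := invmx (B^T *m B) *m B^T; set Fi := F^T *m invmx (F *m F^T).
have BiB : Bi *m B = 1%:M by rewrite -mulmxA mulVmx.
have FFi : F *m Fi = 1%:M by rewrite mulmxA mulmxV.
have MX : B *m F *m (Fi *m Bi) = B *m Bi.
  by rewrite -mulmxA (mulmxA F) FFi mul1mx.
have XM : Fi *m Bi *m (B *m F) = Fi *m F.
  by rewrite -mulmxA (mulmxA Bi) BiB mul1mx.
split.
- by rewrite MX mulmxA -(mulmxA B) BiB mulmx1.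
- by rewrite XM mulmxA -(mulmxA Fi) FFi mulmx1.
- by rewrite MX /Bi !trmx_mul !trmxK trmx_inv trmx_mul trmxK mulmxA.
- by rewrite XM /Fi !trmx_mul !trmxK trmx_inv trmx_mul trmxK mulmxA.
Qed.

Lemma MoorePenroseP (R : realType) (k l : nat) (M : 'M[R]_(k, l)) :
  is_MoorePenrose M (MoorePenrose M).
Proof.
suff [X MX] : exists X, is_MoorePenrose M X.
  by rewrite /MoorePenrose; case: xgetP => [Y _ //|/(_ X)].
have uB : (col_base M)^T *m col_base M \in unitmx.
  by apply: gram_unitmx; exact: eqP (col_base_full M).
have uF : row_base M *m (row_base M)^T \in unitmx.
  have := @gram_unitmx _ _ _ (row_base M)^T; rewrite trmxK mxrank_tr; apply.
  exact: eqP (row_base_free M).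
have := full_rank_product_MoorePenrose uB uF; rewrite mulmx_base => MX.
by eexists; exact: MX.
Qed.

(** * Optimality conditions *)

Lemma sum_squeeze (R : realType) (N : nat) (f g : 'I_N -> R) :
  (forall i, f i <= g i) -> \sum_i g i <= \sum_i f i -> f =1 g.
Proof.
move=> fg gf i; apply/eqP; rewrite eq_sym -subr_eq0; move: gf.
rewrite -subr_ge0 -sumrB => gf.
have d0 j : 0 <= g j - f j by rewrite subr_ge0.
have : \sum_j (g j - f j) == 0.
  rewrite eq_le sumr_ge0 // andbT -oppr_ge0 -sumrN.
  by under eq_bigr => j _ do rewrite opprB.
by rewrite psumr_eq0 // => /allP /(_ i); rewrite mem_index_enum => /(_ isT).
Qed.

Section L1.
Variables (R : realType) (N : nat).
Implicit Types (u v w : 'cV[R]_N) (lam : R).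

Lemma l1norm0 : l1norm (0 : 'cV[R]_N) = 0.
Proof. by rewrite /l1norm big1 // => i _; rewrite mxE normr0. Qed.

Lemma l1normD u v : l1norm (u + v) <= l1norm u + l1norm v.
Proof.
by rewrite -big_split; apply: ler_sum => i _; rewrite mxE ler_normD.
Qed.

Lemma l1normZ a v : 0 <= a -> l1norm (a *: v) = a * l1norm v.
Proof.
move=> a0; rewrite mulr_sumr; apply: eq_bigr => i _.
by rewrite mxE normrM ger0_norm.
Qed.

Lemma coord_le_l1norm v i : `|v i ord0| <= l1norm v.
Proof. by rewrite /l1norm (bigD1 i) //= lerDl sumr_ge0. Qed.

Lemma mul_coord_le lam u v : (forall i, `|u i ord0| <= lam) ->
  forall i, u i ord0 * v i ord0 <= lam * `|v i ord0|.
Proof.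
by move=> ul i; rewrite (le_trans (ler_norm _)) // normrM ler_wpM2r.
Qed.

Lemma dot_le_l1norm lam u v : (forall i, `|u i ord0| <= lam) ->
  dot u v <= lam * l1norm v.
Proof. by move=> ul; rewrite mulr_sumr ler_sum // => i _; apply: mul_coord_le. Qed.

(** Subgradients of [lam * l1norm] at [v]. Complementarity is stated for the sum
    over all coordinates: this form sees [v] only through its norm and its
    pairing with [u], so it transfers between vectors that agree on these. *)
Definition l1_subgrad lam u v :=
  (forall i, `|u i ord0| <= lam) /\ lam * l1norm v <= dot u v.

Lemma l1_subgradP lam u v : l1_subgrad lam u v <->
  forall i, `|u i ord0| <= lam /\ u i ord0 * v i ord0 = lam * `|v i ord0|.
Proof.
split=> [[ul uv] i|uv].
  split=> //; apply: (sum_squeeze (mul_coord_le v ul)).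
  by rewrite -mulr_sumr.
split=> [i|]; first by have [] := uv i.
by rewrite mulr_sumr ler_sum // => i _; have [_ ->] := uv i.
Qed.

Lemma l1_subgrad_dot lam u v : l1_subgrad lam u v -> dot u v = lam * l1norm v.
Proof. by case=> ul uv; apply/eqP; rewrite eq_le uv dot_le_l1norm. Qed.

(** The test vectors [0] and [2 *: v] give complementarity, the signed basis
    vectors give the bound. *)
Lemma l1_subgrad_VI lam u v : 0 <= lam ->
  (forall w, dot u (w - v) <= lam * (l1norm w - l1norm v)) -> l1_subgrad lam u v.
Proof.
move=> lam0 h.
have uv : lam * l1norm v <= dot u v.
  by have := h 0; rewrite l1norm0 !sub0r dotNr mulrN lerN2.
have uv2 : dot u v <= lam * l1norm v.
  have := h (2 *: v); rewrite l1normZ // (_ : 2 *: v - v = v).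
    by rewrite mulr_natl mulr2n addrK.
  by rewrite scaler_nat mulr2n addrK.
split=> // i; have hw w : dot u w <= lam * l1norm w.
  have := h w; rewrite dotDr dotNr mulrBr; lra.
have e a : l1norm (a *: delta_mx i ord0 : 'cV[R]_N) = `|a|.
  rewrite /l1norm (bigD1 i) //= big1 => [|j ji]; last first.
    by rewrite !mxE (negbTE ji) mulr0 normr0.
  by rewrite !mxE !eqxx mulr1 addr0.
have := hw (1 *: delta_mx i ord0); have := hw (-1 *: delta_mx i ord0).
rewrite !e !dotZr !dot_delta normrN1 normr1 ler_norml; lra.
Qed.

End L1.

Section Kkt.
Variables (R : realType) (k N : nat) (C : 'M[R]_(k, N)) (D : 'M[R]_k).
Implicit Types (b : 'cV[R]_k) (w v : 'cV[R]_N) (p q : 'cV[R]_k * R).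

Definition resid b w : 'cV[R]_N := C^T *m (b - D *m C *m w).

(** Optimality at the parameter [p], which pairs the data [p.1] with the
    regularization weight [p.2]. *)
Definition kkt p w := l1_subgrad p.2 (resid p.1 w) w.

Lemma resid_eqC b w v : C *m w = C *m v -> resid b w = resid b v.
Proof. by move=> wv; rewrite /resid -!mulmxA wv. Qed.

Lemma residZD t b w b' w' :
  resid (t *: b + b') (t *: w + w') = t *: resid b w + resid b' w'.
Proof.
rewrite /resid (mulmxDr (D *m C)) -(scalemxAr t (D *m C)) (scalemxAr t C^T).
rewrite -(mulmxDr C^T); congr (_ *m _).
by rewrite scalerBr opprD addrACA.
Qed.

Lemma residD b w b' w' : resid (b + b') (w + w') = resid b w + resid b' w'.
Proof. by have := residZD 1 b w b' w'; rewrite !scale1r. Qed.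

Lemma residZ t b w : resid (t *: b) (t *: w) = t *: resid b w.
Proof.
have := residZD t b w 0 0; rewrite !addr0 => ->.
by rewrite {2}/resid mulmx0 subr0 mulmx0 addr0.
Qed.

Lemma dot_resid b w v : dot (resid b w) v = dot (b - D *m C *m w) (C *m v).
Proof. by rewrite /resid dot_trmx. Qed.

Lemma kkt_transfer p w v : 0 <= p.2 -> kkt p w -> C *m v = C *m w ->
  l1norm v <= l1norm w -> kkt p v.
Proof.
move=> p0 [wl ww] vw vl; rewrite /kkt (resid_eqC _ vw); split=> //.
rewrite (dot_resid _ _ v) vw -dot_resid; apply: le_trans ww.
by rewrite ler_wpM2l.
Qed.

Section Positive.
Variable kap : R.
Hypothesis kap_gt0 : 0 < kap.
Hypothesis D_pos : forall v : 'cV[R]_k, kap * dot v v <= dot v (D *m v).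

Lemma dot_residB b w v :
  dot (resid b v - resid b w) (w - v) =
  dot (C *m (w - v)) (D *m (C *m (w - v))).
Proof.
rewrite /resid -mulmxBr dot_trmx opprD addrACA subrr add0r opprK.
by rewrite [_ + D *m _ *m _]addrC -mulmxBr dotC mulmxA.
Qed.

(** Subgradients are monotone, so [resid w - resid v] pairs nonnegatively with
    [w - v]; but this pairing is minus the quadratic form of [D] at
    [C *m (w - v)], which is positive unless the images agree. *)
Lemma kkt_eqC p w v : kkt p w -> kkt p v -> C *m w = C *m v.
Proof.
move=> [wl ww] [vl vv]; apply/eqP; rewrite -subr_eq0 -mulmxBr; apply/eqP.
apply/dot_eq0/eqP.
rewrite eq_le dot_ge0 andbT -(pmulr_rle0 _ kap_gt0) (le_trans (D_pos _)) //.
rewrite -(dot_residB p.1) !(dotDl, dotDr, dotNl, dotNr).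
have wv := dot_le_l1norm v wl; have vw := dot_le_l1norm w vl.
lra.
Qed.

Lemma kkt_l1norm p w v : 0 < p.2 -> kkt p w -> kkt p v -> l1norm w = l1norm v.
Proof.
move=> p0 kw kv; have Cwv := kkt_eqC kw kv.
have /mulfI : p.2 != 0 by rewrite gt_eqF.
apply.
rewrite -(l1_subgrad_dot kw) -(l1_subgrad_dot kv) (dot_resid _ w w) Cwv.
by rewrite -dot_resid (resid_eqC _ Cwv).
Qed.

Lemma kkt_mid p w v : 0 < p.2 -> kkt p w -> kkt p v -> kkt p (2^-1 *: (w + v)).
Proof.
move=> p0 kw kv; apply: (kkt_transfer (ltW p0) kw).
  rewrite -scalemxAr mulmxDr (kkt_eqC kv kw).
  by rewrite -mulr2n -[X in _ *: X]scaler_nat scalerA mulVf ?scale1r.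
rewrite l1normZ ?invr_ge0 // (le_trans (ler_wpM2l _ (l1normD _ _))) ?invr_ge0 //.
by rewrite -(kkt_l1norm p0 kw kv) -mulr2n -[X in _ * X]mulr_natl mulKf.
Qed.

(** Completing the square in [C *m w] gives a bound that does not depend on
    [w]; with complementarity it bounds the norms of all solutions. *)
Lemma resid_dot_bound b w : dot (resid b w) w <= dot b b / (4 * kap).
Proof.
rewrite dot_resid -mulmxA dotDl dotNl (dotC (D *m _)); set v := C *m w.
have := dot_ge0 (b - (2 * kap) *: v); have := D_pos v.
rewrite !(dotDl, dotDr, dotNl, dotNr, dotZl, dotZr) (dotC v b) => h1 h2.
rewrite ler_pdivlMr ?mulr_gt0 //.
have : 0 <= 4 * kap * (dot v (D *m v) - kap * dot v v).
  by rewrite !mulr_ge0 ?subr_ge0 // ltW.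
lra.
Qed.

End Positive.
End Kkt.

(** * Continuity and minimizers in finite dimension *)

Section Continuity.
Variables (R : realType) (T : topologicalType).

Lemma continuous_sum (I : finType) (f : I -> T -> R) :
  (forall i, continuous (f i)) -> continuous (fun x => \sum_i f i x).
Proof.
move=> fc; apply: continuous_big => [|i _]; last exact: fc.
by move=> z; exact: add_continuous.
Qed.

Lemma continuous_absr (f : T -> R) :
  continuous f -> continuous (fun x => `|f x|).
Proof.
by move=> fc x; apply: (@continuous_comp _ _ _ f); [exact: fc|exact: norm_continuous].
Qed.

Lemma continuous_dot N (F G : T -> 'cV[R]_N) :
  (forall i, continuous (fun x => F x i ord0)) ->
  (forall i, continuous (fun x => G x i ord0)) ->
  continuous (fun x => dot (F x) (G x)).
Proof.
by move=> Fc Gc; apply: continuous_sum => i x; apply: cvgM; [exact: Fc|exact: Gc].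
Qed.

Lemma continuous_mulmx k N (M : 'M[R]_(k, N)) (F : T -> 'cV[R]_N) i :
  (forall j, continuous (fun x => F x j ord0)) ->
  continuous (fun x => (M *m F x) i ord0).
Proof.
move=> Fc; under eq_fun => x do rewrite mxE.
by apply: continuous_sum => j x; apply: cvgM; [exact: cvg_cst|exact: Fc].
Qed.

Lemma continuous_colD N (F G : T -> 'cV[R]_N) i :
  continuous (fun x => F x i ord0) -> continuous (fun x => G x i ord0) ->
  continuous (fun x => (F x + G x) i ord0).
Proof.
move=> Fc Gc; under eq_fun => x do rewrite mxE.
by move=> x; apply: cvgD; [exact: Fc|exact: Gc].
Qed.

Lemma continuous_colN N (F : T -> 'cV[R]_N) i :
  continuous (fun x => F x i ord0) -> continuous (fun x => (- F x) i ord0).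
Proof.
by move=> Fc; under eq_fun => x do rewrite mxE; move=> x; apply: cvgN; exact: Fc.
Qed.

Lemma continuous_colZ N a (F : T -> 'cV[R]_N) i :
  continuous (fun x => F x i ord0) -> continuous (fun x => (a *: F x) i ord0).
Proof.
move=> Fc; under eq_fun => x do rewrite mxE.
by move=> x; apply: cvgM; [exact: cvg_cst|exact: Fc].
Qed.

Lemma closed_le_fun (f g : T -> R) :
  continuous f -> continuous g -> closed [set x | f x <= g x].
Proof.
move=> fc gc; rewrite (_ : mkset _ = (fun x => g x - f x) @^-1` [set y | 0 <= y]).
  have /continuous_closedP clo : continuous (fun x => g x - f x).
    by move=> x; apply: cvgB; [exact: gc|exact: fc].
  by apply: clo; exact: closed_ge.
by apply/seteqP; split=> x /=; rewrite subr_ge0.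
Qed.

End Continuity.

Lemma compact_box (R : realType) N (M : R) :
  compact [set v : 'cV[R]_N | forall i, `|v i ord0| <= M].
Proof.
have cM : compact [set v : 'rV[R]_N | forall i, `[- M, M]%classic (v ord0 i)].
  apply: (@rV_compact _ _ (fun=> `[- M, M]%classic)) => i.
  exact: segment_compact.
have trc : continuous (fun v : 'rV[R]_N => v^T).
  move=> v A /nbhs_ballP[e e0 eA]; apply/nbhs_ballP; exists e => // u [_ vu].
  by apply: eA; split=> // i j; rewrite !mxE; exact: vu.
have := continuous_compact (continuous_subspaceT trc) cM.
congr compact; apply/seteqP; split=> [_ [v vM <-] i|v vM].
  by have := vM i; rewrite /= in_itv /= mxE ler_norml.
exists v^T; last exact: trmxK.
by move=> i; rewrite /= in_itv /= mxE -ler_norml.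
Qed.

Lemma closed_box_argmin (R : realType) N (S : set 'cV[R]_N) (f : 'cV[R]_N -> R) M :
  closed S -> S !=set0 -> (forall v, S v -> forall i, `|v i ord0| <= M) ->
  continuous f -> exists2 w, S w & forall v, S v -> f w <= f v.
Proof.
move=> Scl S0 SM fc.
have Sco : compact S := subclosed_compact Scl (@compact_box _ _ M) SM.
have [w wS wmin] := compact_EVT_min S0 Sco (continuous_subspaceT fc).
exists w; first by rewrite inE in wS.
by move=> v vS; apply: wmin; rewrite inE.
Qed.

(** * Existence of solutions *)

(** A solution is a fixed point of soft-thresholding after a gradient step.
    This map does not expand distances; damping it slightly gives contractions,
    whose fixed points stay bounded, and a limit point solves the problem. *)

Section Soft.
Variable R : realType.
Implicit Types tau a : R.

Definition clamp tau a : R := Num.max (- tau) (Num.min tau a).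
Definition soft tau a : R := a - clamp tau a.

Lemma clamp_norm tau a : 0 <= tau -> `|clamp tau a| <= tau.
Proof.
move=> t0; rewrite /clamp ler_norml; rewrite /Num.max /Num.min.
by case: (ltP tau a) => h1; case: ifPn => h2; apply/andP; split; move: h2;
  rewrite -?leNgt; lra.
Qed.

Lemma clamp_soft tau a : 0 <= tau -> clamp tau a * soft tau a = tau * `|soft tau a|.
Proof.
move=> t0; rewrite /soft /clamp; rewrite /Num.max /Num.min.
case: (ltP tau a) => h1; case: ifPn => h2; move: h2; rewrite -?leNgt => h2.
- by rewrite gtr0_norm; [|lra].
- have -> : tau = 0 by lra.
  by rewrite oppr0 !mul0r.
- by rewrite subrr normr0 !mulr0.
- by rewrite opprK ler0_norm; [ring|lra].
Qed.

Lemma soft_nonexpansive tau a b : 0 <= tau ->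
  (soft tau a - soft tau b) ^+ 2 <= (a - b) ^+ 2.
Proof.
move=> t0; rewrite -[leLHS]real_normK ?num_real // -[leRHS]real_normK ?num_real //.
rewrite ler_pXn2r ?nnegrE // /soft /clamp; rewrite /Num.max /Num.min.
by case: (ltP tau a) => h1; case: ifPn => h2; move: h2; rewrite -?leNgt => h2;
  case: (ltP tau b) => h3; case: ifPn => h4; move: h4; rewrite -?leNgt => h4;
  rewrite ler_norml; case: (ger0P (a - b)) => h5; apply/andP; split; lra.
Qed.

Lemma soft_continuous tau : continuous (soft tau).
Proof.
move=> a; apply: cvgB; first exact: cvg_id.
have h : {for a, continuous
    ((cst (- tau) : R -> R^o) \max ((cst tau : R -> R^o) \min id))}.
  apply: continuous_max; first exact: cvg_cst.
  by apply: continuous_min; [exact: cvg_cst|exact: cvg_id].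
exact: h.
Qed.

End Soft.
(** Young's inequality: it replaces the triangle inequality while keeping
    square norms throughout. *)
Lemma dotD_le (R : realType) N (e : R) (u v : 'cV[R]_N) : 0 < e ->
  dot (u + v) (u + v) <= (1 + e) * dot u u + (1 + e^-1) * dot v v.
Proof.
move=> e0; have := dot_ge0 (e *: u - v).
rewrite !(dotDl, dotDr, dotNl, dotNr, dotZl, dotZr) (dotC v u) => h.
have ei : 0 <= e^-1 by rewrite invr_ge0 ltW.
have := mulr_ge0 ei h.
rewrite (_ : e^-1 * _ = e * dot u u - 2 * dot u v + e^-1 * dot v v); first lra.
by field; rewrite gt_eqF.
Qed.

Section Nonexpansive.
Variables (R : realType) (N : nat) (F : 'cV[R]_N -> 'cV[R]_N).
Hypothesis F_cont : forall i, continuous (fun w => F w i ord0).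
Hypothesis F_nonexp : forall w v,
  dot (F w - F v) (F w - F v) <= dot (w - v) (w - v).

(** A damped nonexpansive map sends a large ball into itself; at a point of
    this ball that moves least, the displacement must vanish, since applying
    the map once more contracts it. *)
Lemma damped_fixpoint (e : R) : 0 < e < 1 -> exists w, w = (1 - e) *: F w.
Proof.
move=> /andP[e0 e1].
(* The ball of square radius [r] is stable because
   [(1 - e) ^+ 2 * ((1 + e) + e) <= 1]. *)
pose r := (1 + e^-1) * dot (F 0) (F 0) / e.
have r0 : 0 <= r.
  by rewrite /r divr_ge0 ?mulr_ge0 ?dot_ge0 ?addr_ge0 ?invr_ge0 ?ltW.
pose G w := (1 - e) *: F w.
have Gr w : dot w w <= r -> dot (G w) (G w) <= r.
  move=> wr; rewrite dotZl dotZr mulrA.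
  have := dotD_le (F w - F 0) (F 0) e0; rewrite subrK => h.
  have := F_nonexp w 0; rewrite subr0 => h2.
  have h3 : dot (F w) (F w) <= (1 + e) * r + e * r.
    apply: le_trans h _; apply: lerD.
      by rewrite ler_wpM2l ?(le_trans h2) // addr_ge0 // ltW.
    by rewrite [e * r]mulrC divfK // gt_eqF.
  have := ler_wpM2l (mulr_ge0 (_ : 0 <= 1 - e) (_ : 0 <= 1 - e)) h3.
  rewrite subr_ge0 (ltW e1) => /(_ isT isT) h4; apply: le_trans h4 _.
  rewrite -subr_ge0.
  have -> : r - (1 - e) * (1 - e) * ((1 + e) * r + e * r) =
    e ^+ 2 * (3 - 2 * e) * r by ring.
  by apply: mulr_ge0 => //; apply: mulr_ge0; [exact: sqr_ge0|lra].
have Gc i : continuous (fun w => G w i ord0) by exact: continuous_colZ.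
have idc i : continuous (fun w : 'cV[R]_N => w i ord0) by exact: coord_continuous.
have wGc i : continuous (fun w : 'cV[R]_N => (w - G w) i ord0).
  by apply: continuous_colD => //; exact: continuous_colN.
have [||w wr||w wr wmin] := @closed_box_argmin R N [set w | dot w w <= r]
    (fun w => dot (w - G w) (w - G w)) (r + 1).
- by apply: closed_le_fun; [exact: continuous_dot|exact: cst_continuous].
- by exists 0; rewrite /= dot0l.
- move=> i; have := le_trans (sqr_coord_le_dot w i) wr.
  rewrite -[X in X <= _ -> _]real_normK ?num_real // => h.
  rewrite leNgt; apply/negP => hlt.
  have : (r + 1) ^+ 2 <= `|w i ord0| ^+ 2.
    by rewrite ler_pXn2r ?nnegrE ?(ltW hlt) // addr_ge0.
  rewrite -subr_ge0 => h5; have : 0 <= r ^+ 2 by rewrite sqr_ge0.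
  lra.
- exact: continuous_dot.
exists w; apply/eqP; rewrite -subr_eq0; apply/eqP/dot_eq0/eqP.
rewrite eq_le dot_ge0 andbT; have := wmin _ (Gr _ wr).
rewrite -scalerBr dotZl dotZr => /le_trans.
move=> /(_ _ (ler_wpM2l _ (ler_wpM2l _ (F_nonexp _ _)))).
rewrite subr_ge0 (ltW e1) => /(_ isT isT); rewrite -/(G w).
have := dot_ge0 (w - G w); set x := dot _ _ => x0.
rewrite -subr_ge0 (_ : _ - _ = - (e * (2 - e) * x)); last by ring.
by rewrite oppr_ge0 pmulr_rle0 // mulr_gt0 //; lra.
Qed.

(** A damped fixed point [w] is displaced by [F] by [e / (1 - e) *: w], so along
    bounded ones the least displacement on the box is [0]; it is attained. *)
Lemma bounded_nonexpansive_fixpoint (M : R) :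
  (forall (e : R) (w : 'cV[R]_N), 0 < e <= 2^-1 -> w = (1 - e) *: F w ->
     forall i, `|w i ord0| <= M) ->
  exists w, F w = w.
Proof.
move=> FM.
have idc i : continuous (fun w : 'cV[R]_N => w i ord0) by exact: coord_continuous.
have wFc i : continuous (fun w : 'cV[R]_N => (w - F w) i ord0).
  by apply: continuous_colD => //; exact: continuous_colN.
have half : 0 < (2^-1 : R) <= 2^-1 by rewrite lexx andbT invr_gt0.
have ex (e : R) : 0 < e <= 2^-1 ->
    exists2 w : 'cV[R]_N, (forall i, `|w i ord0| <= M) & w = (1 - e) *: F w.
  move=> e12; have [w we] : exists w, w = (1 - e) *: F w.
    by apply: damped_fixpoint; case/andP: e12 => -> /=; lra.
  by exists w => //; exact: FM we.
have [||//||w wM wmin] := @closed_box_argmin R N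
    [set w : 'cV[R]_N | forall i, `|w i ord0| <= M]
    (fun w => dot (w - F w) (w - F w)) M.
- rewrite (_ : mkset _ =
      \bigcap_(i in setT) [set w : 'cV[R]_N | `|w i ord0| <= M]); last first.
    by apply/seteqP; split=> [w wM i _|w wM i]; exact: wM.
  apply: closed_bigI => i _; apply: closed_le_fun; last exact: cst_continuous.
  by apply: continuous_absr; exact: idc.
- by have [w wM _] := ex _ half; exists w.
- exact: continuous_dot.
exists w; apply/esym/eqP; rewrite -subr_eq0; apply/eqP/dot_eq0/eqP.
rewrite eq_le dot_ge0 andbT leNgt; apply/negP; set f0 := dot _ _ in wmin * => f0_gt0.
(* Since [1 - e >= 2^-1], damped fixed points have images in the box of
   radius [2 * M], whose square norms are at most [B]. *)
pose B : R := \sum_(i < N) (2 * M) ^+ 2.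
have B0 : 0 <= B by apply: sumr_ge0 => i _; exact: sqr_ge0.
pose e := Num.min 2^-1 (f0 / (2 * (B + 1))).
have e0 : 0 < e by rewrite lt_min invr_gt0 ltr0n /= divr_gt0 // mulr_gt0 //; lra.
have e12 : e <= 2^-1 by rewrite ge_min lexx.
have [v vM ve] := ex e (introT andP (conj e0 e12)).
have Fv : v - F v = - (e *: F v) by rewrite {1}ve scalerBl scale1r addrC addKr.
have FvB : dot (F v) (F v) <= B.
  apply: ler_sum => i _; rewrite -expr2 -[leLHS]real_normK ?num_real //.
  have h : `|F v i ord0| <= 2 * M.
    have := vM i; rewrite {1}ve mxE normrM gtr0_norm; last by lra.
    have := normr_ge0 (F v i ord0); nra.
  by rewrite ler_pXn2r ?nnegrE // (le_trans _ h).
have := wmin v vM; rewrite Fv dotNl dotNr opprK dotZl dotZr mulrA => h.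
have : e * e * dot (F v) (F v) <= e * B.
  rewrite -mulrA ler_wpM2l ?(ltW e0) // (le_trans _ FvB) // ler_piMl ?dot_ge0 //; lra.
have : e * (2 * (B + 1)) <= f0.
  by rewrite -ler_pdivlMr ?ge_min ?lexx ?orbT // mulr_gt0 //; lra.
have : 0 < e * B + 2 * e by rewrite ltr_wpDl ?mulr_ge0 ?mulr_gt0 // ltW.
lra.
Qed.

End Nonexpansive.
Section Existence.
Variables (R : realType) (k N : nat) (C : 'M[R]_(k, N)) (D : 'M[R]_k).
Implicit Types (b : 'cV[R]_k) (w v : 'cV[R]_N) (p : 'cV[R]_k * R).

(** One step of the proximal gradient (iterative soft-thresholding) scheme. *)
Definition prox_step gam p w : 'cV[R]_N :=
  \col_i soft (gam * p.2) ((w + gam *: resid C D p.1 w) i ord0).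

Lemma prox_step_subgrad gam p w : 0 <= gam * p.2 ->
  l1_subgrad (gam * p.2) (w + gam *: resid C D p.1 w - prox_step gam p w)
    (prox_step gam p w).
Proof.
move=> t0; set a := w + _; apply/l1_subgradP => i.
have E : prox_step gam p w i ord0 = soft (gam * p.2) (a i ord0) by rewrite mxE.
have -> : (a - prox_step gam p w) i ord0 = clamp (gam * p.2) (a i ord0).
  have -> : (a - prox_step gam p w) i ord0 =
      a i ord0 - prox_step gam p w i ord0 by rewrite !mxE.
  by rewrite E /soft opprB addrC subrK.
by rewrite E; split; [exact: clamp_norm|exact: clamp_soft].
Qed.

Lemma prox_step_fixpoint_kkt gam p w : 0 < gam -> 0 <= p.2 ->
  prox_step gam p w = w -> kkt C D p w.
Proof.
move=> g0 p0 wE; have := @prox_step_subgrad gam p w (mulr_ge0 (ltW g0) p0).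
rewrite wE addrC addKr => -[h1 h2]; split=> [i|].
  by have := h1 i; rewrite mxE normrM gtr0_norm // ler_pM2l.
by move: h2; rewrite dotZl -mulrA ler_pM2l.
Qed.

Lemma continuous_resid b i : continuous (fun w => resid C D b w i ord0).
Proof.
apply: continuous_mulmx => j; apply: continuous_colD; first exact: cst_continuous.
apply: continuous_colN; apply: continuous_mulmx => l; exact: coord_continuous.
Qed.

Lemma continuous_prox_step gam p i :
  continuous (fun w => prox_step gam p w i ord0).
Proof.
rewrite (_ : (fun w => _) = soft (gam * p.2) \o
    (fun w => (w + gam *: resid C D p.1 w) i ord0)); last first.
  by apply/funext => w; rewrite [LHS]mxE.
move=> w; apply: continuous_comp; last exact: soft_continuous.
apply: continuous_colD; first exact: coord_continuous.
by apply: continuous_colZ; exact: continuous_resid.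
Qed.

Lemma closed_kkt p : closed [set w | kkt C D p w].
Proof.
have rc i : continuous (fun w => resid C D p.1 w i ord0) by exact: continuous_resid.
rewrite (_ : mkset _ = \bigcap_(i in setT)
    [set w : 'cV[R]_N | `|resid C D p.1 w i ord0| <= p.2] `&`
    [set w : 'cV[R]_N | p.2 * l1norm w <= dot (resid C D p.1 w) w]).
  apply: closedI.
    apply: closed_bigI => i _; apply: closed_le_fun; last exact: cst_continuous.
    exact: continuous_absr.
  apply: closed_le_fun; last first.
    by apply: continuous_dot => // i; exact: coord_continuous.
  have l1c : continuous (@l1norm R N).
    apply: (@continuous_sum _ _ _ (fun i (w : 'cV[R]_N) => `|w i ord0|)) => i.
    apply: (@continuous_absr _ _ (fun w : 'cV[R]_N => w i ord0)).
    exact: coord_continuous.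
  move=> w; apply: (@continuousM _ _ (fun=> p.2) (@l1norm R N)); last exact: l1c.
  exact: cst_continuous.
by apply/seteqP; split=> w [h1 h2]; split=> // i; [move=> _|]; exact: h1.
Qed.

Variable kap : R.
Hypothesis kap_gt0 : 0 < kap.
Hypothesis D_pos : forall v : 'cV[R]_k, kap * dot v v <= dot v (D *m v).

(** The linear part [M = C^T *m D *m C] of the residual is cocoercive: both
    [dot u (M *m u)] and the square norm of [M *m u] are comparable to the square
    norm of [C *m u]. Hence a short gradient step does not expand distances, and
    soft-thresholding never does. *)
Lemma prox_step_nonexpansive : exists2 gam, 0 < gam & forall p w v, 0 <= p.2 ->
  dot (prox_step gam p w - prox_step gam p v) (prox_step gam p w - prox_step gam p v)
    <= dot (w - v) (w - v).
Proof.
have [K K0 KP] := mulmx_bounded (C^T *m D).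
exists (kap / K) => [|p w v p0]; first exact: divr_gt0.
set gam := kap / K; have g0 : 0 < gam by exact: divr_gt0.
pose a x := x + gam *: resid C D p.1 x.
apply: (@le_trans _ _ (dot (a w - a v) (a w - a v))).
  apply: ler_sum => i _; rewrite -!expr2.
  have -> : (prox_step gam p w - prox_step gam p v) i ord0 =
      soft (gam * p.2) (a w i ord0) - soft (gam * p.2) (a v i ord0) by rewrite !mxE.
  have -> : (a w - a v) i ord0 = a w i ord0 - a v i ord0 by rewrite !mxE.
  rewrite soft_nonexpansive //; by rewrite mulr_ge0 // ltW.
set u := w - v; pose q := dot (C *m u) (C *m u).
have -> : a w - a v = u - gam *: (C^T *m D *m (C *m u)).
  rewrite /a /u opprD addrACA -scalerBr -scalerN; congr (_ + _ *: _).
  rewrite /resid -mulmxBr opprD addrACA subrr add0r -opprD -mulmxBr mulmxN.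
  by rewrite !mulmxA.
clearbody u.
rewrite !(dotDl, dotDr, dotNl, dotNr, dotZl, dotZr) (dotC _ u).
have h1 : dot u (C^T *m D *m (C *m u)) = dot (C *m u) (D *m (C *m u)).
  by rewrite -mulmxA dot_trmxr.
have := KP (C *m u); have := D_pos (C *m u); rewrite -h1 -/q.
set x := dot u _; set y := dot (C^T *m _ *m _) _ => h2 h3.
have q0 : 0 <= q by exact: dot_ge0.
have e1 : gam * K = kap by rewrite /gam divfK // gt_eqF.
have h4 : gam * (kap * q) <= gam * x by rewrite ler_pM2l.
have h5 : gam * (gam * y) <= gam * (gam * (K * q)) by rewrite !ler_pM2l.
have h6 : gam * (gam * (K * q)) = gam * (kap * q) by rewrite -e1 !mulrA.
have h7 : 0 <= gam * (kap * q).
  by apply: mulr_ge0; [exact: ltW|apply: mulr_ge0; first exact: ltW].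
lra.
Qed.

(** The damped fixed points satisfy complementarity up to the term
    [- e * dot u u], whose sign preserves the bound of [resid_dot_bound]. *)
Lemma exists_kkt p : 0 < p.2 -> exists w, kkt C D p w.
Proof.
move=> p0; have [gam g0 gP] := prox_step_nonexpansive.
suff [w wE] : exists w, prox_step gam p w = w.
  by exists w; apply: prox_step_fixpoint_kkt wE => //; exact: ltW.
apply: (@bounded_nonexpansive_fixpoint _ _ (prox_step gam p) _ _
  (dot p.1 p.1 / (4 * kap) / p.2)).
- exact: continuous_prox_step.
- by move=> w v; apply: gP; exact: ltW.
move=> e w /andP[e0 e2] we i; rewrite ler_pdivlMr // mulrC.
apply: le_trans (ler_wpM2l (ltW p0) (coord_le_l1norm w i)) _.
apply: le_trans (resid_dot_bound C kap_gt0 D_pos p.1 w).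
have [_] := @prox_step_subgrad gam p w (mulr_ge0 (ltW g0) (ltW p0)).
set u := prox_step gam p w in we *.
have e1 : 0 < 1 - e by lra.
have -> : l1norm w = (1 - e) * l1norm u by rewrite -l1normZ -?we // ltW.
have -> : dot (resid C D p.1 w) w = (1 - e) * dot (resid C D p.1 w) u.
  by rewrite -dotZr -we.
have wu : dot w u = (1 - e) * dot u u by rewrite -dotZl -we.
rewrite mulrCA ler_pM2l // !dotDl dotNl dotZl wu => h.
rewrite -(ler_pM2l g0) mulrA; apply: le_trans h _.
have : 0 <= e * dot u u by rewrite mulr_ge0 ?dot_ge0 // ltW.
lra.
Qed.

Lemma kkt_bounded p w i : 0 < p.2 -> kkt C D p w ->
  `|w i ord0| <= dot p.1 p.1 / (4 * kap) / p.2.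
Proof.
move=> p0 [_ kw]; rewrite ler_pdivlMr // mulrC.
apply: le_trans (ler_wpM2l (ltW p0) (coord_le_l1norm w i)) _.
exact: le_trans kw (resid_dot_bound C kap_gt0 D_pos p.1 w).
Qed.

Lemma exists_min_norm p : 0 < p.2 -> exists w, is_min_norm [set w | kkt C D p w] w.
Proof.
move=> p0; have [w kw] := exists_kkt p0.
have [||v kv vmin] := closed_box_argmin (f := fun w => dot w w) (@closed_kkt p)
    _ (fun w kw i => kkt_bounded i p0 kw).
- by exists w.
- by apply: continuous_dot => i; exact: coord_continuous.
by exists v; split=> // v' kv'; rewrite ler_l2norm; exact: vmin.
Qed.

(** The midpoint of two solutions is a solution, shorter than both unless they
    coincide. *)
Lemma min_norm_unique p w v : 0 < p.2 ->
  is_min_norm [set w | kkt C D p w] w -> is_min_norm [set w | kkt C D p w] v ->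
  w = v.
Proof.
move=> p0 [kw wmin] [kv vmin].
have := vmin _ (kkt_mid kap_gt0 D_pos p0 kw kv).
have := wmin _ (kkt_mid kap_gt0 D_pos p0 kw kv).
rewrite !ler_l2norm !(dotDl, dotDr, dotZl, dotZr) (dotC v w) => h1 h2.
apply/eqP; rewrite -subr_eq0; apply/eqP/dot_eq0/eqP; rewrite eq_le dot_ge0 andbT.
rewrite !(dotDl, dotDr, dotNl, dotNr) (dotC v w); lra.
Qed.

End Existence.

(** * Sign cells of the minimum-norm solution *)

Lemma ge0_of_small (R : realType) (T a b : R) : 0 < T ->
  (forall t, 0 < t <= T -> 0 <= a + t * b) -> 0 <= a.
Proof.
move=> T0 h; rewrite leNgt; apply/negP => a0.
have b1 : 0 < `|b| + 1 by rewrite ltr_wpDl.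
pose t := Num.min T (- a / (2 * (`|b| + 1))).
have t0 : 0 < t by rewrite lt_min T0 divr_gt0 ?oppr_gt0 // mulr_gt0.
have := h t; rewrite t0 ge_min lexx /= => /(_ isT).
have : t * (2 * (`|b| + 1)) <= - a.
  by rewrite -ler_pdivlMr ?mulr_gt0 // ge_min lexx orbT.
have : t * b <= t * `|b| by rewrite ler_pM2l // ler_norm.
lra.
Qed.

Lemma eq0_of_positive (R : realType) (a b : R) :
  (forall t, 0 < t -> a + t * b = 0) -> a = 0.
Proof. by move=> h; have := h 1 ltr01; have := h 2 (ltr0Sn _ 1); lra. Qed.

Lemma sgrD_eq (R : realDomainType) (a b : R) :
  Num.sg a = Num.sg b -> Num.sg (a + b) = Num.sg b.
Proof.
case: (sgrP b) => [->|b0|b0] /eqP; rewrite sgr_cp0.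
- by move=> /eqP ->; rewrite addr0 sgr0.
- by move=> a0; rewrite gtr0_sg // addr_gt0.
- by move=> a0; rewrite ltr0_sg // -oppr_gt0 opprD addr_gt0 ?oppr_gt0.
Qed.

Section Extend0.
Variables (R : realType) (N : nat) (E : {set 'I_N}).
Implicit Types (u v : 'cV[R]_#|E|) (w : 'cV[R]_N).

Lemma mul_colsE k (M : 'M[R]_(k, N)) v : colsE M E *m v = M *m extend0 v.
Proof. by rewrite /extend0 mulmxA /colsE mulmx_colsub mulmx1. Qed.

Lemma trmx_colsE_mul k (M : 'M[R]_(k, N)) x :
  (colsE M E)^T *m x = subvec (M^T *m x) E.
Proof. by apply/colP => i; rewrite !mxE; apply: eq_bigr => j _; rewrite !mxE. Qed.

Lemma dot_extend0 v w : dot (extend0 v) w = dot v (subvec w E).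
Proof.
rewrite /extend0 -dot_trmxr trmx_colsE_mul.
by rewrite trmx1 mul1mx.
Qed.

Lemma extend0_out v i : i \notin E -> extend0 v i ord0 = 0.
Proof.
move=> iE; rewrite mxE big1 // => j _; rewrite !mxE.
case: eqP => [ij|_]; last by rewrite mul0r.
by move: iE; rewrite ij enum_valP.
Qed.

Lemma extend0_subvec w : (forall i, i \notin E -> w i ord0 = 0) ->
  extend0 (subvec w E) = w.
Proof.
move=> w0; apply/colP => i; have [iE|iE] := boolP (i \in E); last first.
  by rewrite extend0_out ?w0.
rewrite mxE (bigD1 (enum_rank_in iE i)) //= big1 => [|j ji].
  by rewrite !mxE enum_rankK_in // eqxx mul1r addr0.
rewrite !mxE (_ : i == enum_val j = false) ?mul0r //.
by apply: contra_neqF ji => /eqP ij; rewrite -(enum_valK_in iE j) -ij.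
Qed.

Lemma subvec_extend0 v : subvec (extend0 v) E = v.
Proof.
apply/colP => j; rewrite mxE mxE (bigD1 j) //= big1 => [|l lj].
  by rewrite !mxE eqxx mul1r addr0.
by rewrite !mxE (inj_eq enum_val_inj) eq_sym (negbTE lj) mul0r.
Qed.

End Extend0.

Section Cells.
Variables (R : realType) (k N : nat) (C : 'M[R]_(k, N)) (D : 'M[R]_k).
Variable kap : R.
Hypothesis kap_gt0 : 0 < kap.
Hypothesis D_pos : forall v : 'cV[R]_k, kap * dot v v <= dot v (D *m v).
Implicit Types (b : 'cV[R]_k) (w v h s : 'cV[R]_N) (p q : 'cV[R]_k * R).

Local Notation kktCD := (kkt C D).
Local Notation residCD := (resid C D).
Local Notation is_sol p := (is_min_norm [set w | kktCD p w]).

(** Directions that keep [C *m w], and whose new support respects the sign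
    pattern of the residual, are feasible: short steps do not flip the signs
    of the support of [w]. *)
Lemma kkt_step p w h : 0 <= p.2 -> kktCD p w -> C *m h = 0 ->
  (forall i, w i ord0 = 0 -> residCD p.1 w i ord0 * h i ord0 = p.2 * `|h i ord0|) ->
  exists2 T, 0 < T & forall t, 0 < t <= T -> kktCD p (w + t *: h).
Proof.
move=> p0 /l1_subgradP kw Ch hw.
(* For [t <= B^-1] each [t * h i] is at most [w i] in absolute value; the
   indices with [w i = 0] contribute [0], as division by [0] yields [0]. *)
pose B : R := 1 + \sum_i `|h i ord0| / `|w i ord0|.
have S0 i : 0 <= `|h i ord0| / `|w i ord0| by rewrite divr_ge0.
have B0 : 0 < B by rewrite ltr_pwDl // sumr_ge0.
exists B^-1; first by rewrite invr_gt0.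
move=> t /andP[t0 tB].
have rE : residCD p.1 (w + t *: h) = residCD p.1 w.
  by apply: resid_eqC; rewrite mulmxDr -scalemxAr Ch scaler0 addr0.
apply/l1_subgradP => i; rewrite rE; have [rl rw] := kw i; split=> //.
have -> : (w + t *: h) i ord0 = w i ord0 + t * h i ord0 by rewrite !mxE.
have [wi0|wi0] := eqVneq (w i ord0) 0.
  by rewrite wi0 !add0r mulrCA hw // normrM gtr0_norm // mulrCA.
have hle : t * `|h i ord0| <= `|w i ord0|.
  rewrite -[leRHS]mul1r -ler_pdivrMr ?normr_gt0 // -mulrA.
  have : t * B <= 1 by rewrite -ler_pdivlMr // div1r.
  apply: le_trans; rewrite ler_pM2l //.
  by rewrite /B (bigD1 i) //= ler_wpDl // lerDl sumr_ge0.
have := ler_norm (t * h i ord0); have := ler_norm (- (t * h i ord0)).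
rewrite normrN normrM (gtr0_norm t0) => h1 h2.
move: hle rw wi0; case: (ltrgt0P (w i ord0)) => // wi hle rw _.
  have -> : residCD p.1 w i ord0 = p.2 by move: rw; apply: mulIf; rewrite gt_eqF.
  by rewrite ger0_norm //; lra.
have -> : residCD p.1 w i ord0 = - p.2.
  by move: rw; rewrite mulrN -mulNr; apply: mulIf; rewrite lt_eqF.
by rewrite ler0_norm ?mulrN ?mulNr //; lra.
Qed.

(** First-order optimality of the norm: a short step along [h] remains a solution,
    so it cannot decrease the norm. *)
Lemma min_norm_dir p w h : 0 <= p.2 -> is_sol p w -> C *m h = 0 ->
  (forall i, w i ord0 = 0 -> residCD p.1 w i ord0 * h i ord0 = p.2 * `|h i ord0|) ->
  0 <= dot w h.
Proof.
move=> p0 [kw wmin] Ch hw; have [T T0 TP] := kkt_step p0 kw Ch hw.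
apply: (@ge0_of_small _ T _ (2^-1 * dot h h) T0) => t tT.
have := wmin _ (TP t tT); rewrite ler_l2norm.
rewrite !(dotDl, dotDr, dotZl, dotZr) (dotC h w) => h1.
have t0 : 0 < t by case/andP: tT.
rewrite -(pmulr_rge0 _ (mulr_gt0 (ltr0Sn R 1) t0)); lra.
Qed.

Definition eq_fit s p : 'cV[R]_N :=
  let E := supp s in
  let CE := colsE C E in
  extend0 (MoorePenrose (CE^T *m D *m CE) *m (CE^T *m p.1 - p.2 *: subvec s E)).

Lemma eq_fitZD s t p q : eq_fit s (t *: p + q) = t *: eq_fit s p + eq_fit s q.
Proof.
rewrite /eq_fit /extend0; set CE := colsE C _; set X := MoorePenrose _.
have -> : CE^T *m (t *: p + q).1 - (t *: p + q).2 *: subvec s (supp s) =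
    t *: (CE^T *m p.1 - p.2 *: subvec s (supp s)) +
    (CE^T *m q.1 - q.2 *: subvec s (supp s)).
  by rewrite /= mulmxDr -scalemxAr scalerBr scalerA scalerDl opprD addrACA.
move: (CE^T *m p.1 - _) (CE^T *m q.1 - _) => u v.
by rewrite mulmxDr -scalemxAr mulmxDr -scalemxAr.
Qed.

(** Conditions (EQ) and (NQ) together. Optimality is made part of the
    definition, and the equation [s i * w i = `|w i|] expresses both the sign
    condition on the support of [s] and the vanishing of [w] off it. *)
Definition fits s p w := [/\ kktCD p w,
  forall i, s i ord0 != 0 -> residCD p.1 w i ord0 = p.2 * s i ord0 &
  forall i, s i ord0 * w i ord0 = `|w i ord0| ].

Lemma fits_dot s p q w v : fits s p w -> fits s q v ->
  dot (residCD p.1 w) v = p.2 * l1norm v.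
Proof.
move=> [_ ps _] [_ _ sv]; rewrite mulr_sumr; apply: eq_bigr => i _.
have [s0|s0] := eqVneq (s i ord0) 0.
  by have := sv i; rewrite s0 mul0r => /esym/normr0_eq0 ->; rewrite normr0 !mulr0.
by rewrite ps // -mulrA sv.
Qed.

(** Adding parameters adds residuals, so solutions add up when each is
    complementary to the residual of the other. *)
Lemma kktD p q w v : 0 <= p.2 -> 0 <= q.2 -> kktCD p w -> kktCD q v ->
  dot (residCD p.1 w) v = p.2 * l1norm v -> dot (residCD q.1 v) w = q.2 * l1norm w ->
  kktCD (p + q) (w + v).
Proof.
move=> p0 q0 kw kv pv qw; rewrite /kkt /= residD.
split=> [i|].
  rewrite mxE (le_trans (ler_normD _ _)) // lerD //.
    by have [] := kw.
  by have [] := kv.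
rewrite !dotDl !dotDr pv qw (l1_subgrad_dot kw) (l1_subgrad_dot kv).
have := l1normD w v; have : 0 <= p.2 + q.2 by rewrite addr_ge0.
move=> pq0 /(ler_wpM2l pq0); lra.
Qed.

Lemma kktZ c p w : 0 < c -> kktCD p w -> kktCD (c *: p) (c *: w).
Proof.
move=> c0 [wl ww]; rewrite /kkt /= residZ; split=> [i|].
  by rewrite mxE normrM gtr0_norm // ler_pM2l.
rewrite dotZl dotZr l1normZ ?(ltW c0) //.
have -> : c *: p.2 * (c * l1norm w) = c * (c * (p.2 * l1norm w)).
  by rewrite -[c *: p.2]/(c * p.2); ring.
by rewrite !ler_pM2l.
Qed.

Lemma fitsD s p q w v : 0 <= p.2 -> 0 <= q.2 -> fits s p w -> fits s q v ->
  fits s (p + q) (w + v).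
Proof.
move=> p0 q0 fw fv; have pv := fits_dot fw fv; have qw := fits_dot fv fw.
case: (fw) => kw ps sw; case: (fv) => kv qs sv; have kwv := kktD p0 q0 kw kv pv qw.
split=> // i.
  by move=> s0; rewrite residD mxE ps // qs // mulrDl.
have e : s i ord0 * (w + v) i ord0 = `|w i ord0| + `|v i ord0|.
  by rewrite mxE mulrDr sw sv.
have [w0|w0] := eqVneq (w i ord0) 0; first by rewrite e mxE w0 normr0 !add0r.
have s1 : `|s i ord0| = 1.
  have /(congr1 Num.norm) := sw i; rewrite normrM normr_id -[RHS]mul1r.
  by apply: mulIf; rewrite normr_eq0.
by rewrite -[RHS]mul1r -s1 -normrM e ger0_norm // addr_ge0.
Qed.

Lemma fitsZ s c p w : 0 < c -> fits s p w -> fits s (c *: p) (c *: w).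
Proof.
move=> c0 [kw ps sw]; split; first exact: kktZ.
  by move=> i s0; rewrite /= residZ mxE ps // mulrA.
by move=> i; rewrite mxE normrM gtr0_norm // mulrCA sw.
Qed.

(** Adding arbitrarily small multiples of a compatible pair does not hide an
    incompatibility. *)
Lemma fits_limit s p q w v :
  (forall t, 0 < t -> fits s (t *: q + p) (t *: v + w)) -> fits s p w.
Proof.
move=> h.
have coord (x y : 'cV[R]_N) t i :
    (t *: y + x) i ord0 = x i ord0 + t * y i ord0.
  by rewrite !mxE addrC.
have sw i : s i ord0 * w i ord0 = `|w i ord0|.
  have sw1 t : 0 < t ->
      s i ord0 * (w i ord0 + t * v i ord0) = `|w i ord0 + t * v i ord0|.
    by move=> t0; have [_ _ /(_ i)] := h t t0; rewrite coord.
  apply/eqP; rewrite eq_le; apply/andP; split; rewrite -subr_ge0.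
    apply: (@ge0_of_small _ 1 _ (`|v i ord0| - s i ord0 * v i ord0) ltr01).
    move=> t /andP[t0 _].
    have := sw1 t t0; have := ler_normD (w i ord0) (t * v i ord0).
    rewrite normrM gtr0_norm //; lra.
  apply: (@ge0_of_small _ 1 _ (`|v i ord0| + s i ord0 * v i ord0) ltr01).
  move=> t /andP[t0 _].
  have := sw1 t t0; have := ler_normB (w i ord0 + t * v i ord0) (t * v i ord0).
  rewrite addrK normrM gtr0_norm //; lra.
have rl i : `|residCD p.1 w i ord0| <= p.2.
  rewrite -subr_ge0.
  apply: (@ge0_of_small _ 1 _ (q.2 + `|residCD q.1 v i ord0|) ltr01).
  move=> t /andP[t0 _].
  have [[+ _] _ _] := h t t0 => /(_ i); rewrite /= residZD coord.
  have := ler_normB (residCD p.1 w i ord0 + t * residCD q.1 v i ord0)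
    (t * residCD q.1 v i ord0).
  rewrite addrK normrM gtr0_norm // -[t *: q.2]/(t * q.2); lra.
have rs i : s i ord0 != 0 -> residCD p.1 w i ord0 = p.2 * s i ord0.
  move=> s0; apply/eqP; rewrite -subr_eq0; apply/eqP.
  apply: (@eq0_of_positive _ _ (residCD q.1 v i ord0 - q.2 * s i ord0)) => t t0.
  have [_ /(_ i s0) + _] := h t t0; rewrite /= residZD coord -[t *: q.2]/(t * q.2).
  lra.
split=> //; apply/l1_subgradP => i; split=> //.
have [s0|s0] := eqVneq (s i ord0) 0; last by rewrite rs // -mulrA sw.
by have := sw i; rewrite s0 mul0r => /esym/normr0_eq0 ->; rewrite normr0 !mulr0.
Qed.

Variable sol : 'cV[R]_k * R -> 'cV[R]_N.
Hypothesis solP : forall p, 0 < p.2 -> is_sol p (sol p).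

Lemma sol_eq p w : 0 < p.2 -> is_sol p w -> sol p = w.
Proof. by move=> p0; apply: (min_norm_unique kap_gt0 D_pos p0); exact: solP. Qed.

Definition cell s : set ('cV[R]_k * R) := [set p | 0 < p.2 /\ signv (sol p) = s].

Lemma signv_mul w i : signv w i ord0 * w i ord0 = `|w i ord0|.
Proof. by rewrite mxE normrEsg. Qed.

Lemma signv_eq0 w i : (signv w i ord0 == 0) = (w i ord0 == 0).
Proof. by rewrite mxE sgr_eq0. Qed.

Lemma kkt_fits p w : kktCD p w -> fits (signv w) p w.
Proof.
move=> kw; split=> // i; last exact: signv_mul.
rewrite signv_eq0 => w0; have /l1_subgradP/(_ i) [_] := kw.
by rewrite normrEsg mulrA [signv _ _ _]mxE => /(mulIf w0).
Qed.

Lemma cell_fits s p : cell s p -> fits s p (sol p).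
Proof. by move=> [p0 <-]; apply: kkt_fits; have [] := solP p0. Qed.

(** A solution whose support is that of [s] differs from the least-squares fit
    by a null direction of [C] supported on [supp s], along which it could be
    shortened; the fit itself is orthogonal to such directions. *)
Lemma cell_eq_fit s p : cell s p -> sol p = eq_fit s p.
Proof.
move=> sp; have [kw ps sw] := cell_fits sp; have [p0 sE] := sp.
have wmin := solP p0; set w := sol p in kw ps sw sE wmin *.
rewrite /eq_fit; set E := supp s; set CE := colsE C E.
set M := CE^T *m D *m CE; set X := MoorePenrose M.
have [MXM XMX _ XMt] := MoorePenroseP M; rewrite -/X in MXM XMX XMt.
have wE : extend0 (subvec w E) = w.
  apply: extend0_subvec => i; rewrite inE negbK -sE signv_eq0.
  by move/eqP.
set u := subvec w E in wE *.
have Mu : M *m u = CE^T *m p.1 - p.2 *: subvec s E.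
  have : subvec (residCD p.1 w) E = p.2 *: subvec s E.
    apply/colP => j; rewrite [LHS]mxE ps; first by rewrite !mxE.
    by have := enum_valP j; rewrite inE.
  rewrite -trmx_colsE_mul -[in X in _ *m X]wE -(mulmxA D) -mul_colsE mulmxBr => <-.
  by rewrite opprB addrC subrK !mulmxA.
rewrite -Mu; set e := X *m (M *m u) - u.
have Me : M *m e = 0 by rewrite mulmxBr (mulmxA M X) (mulmxA (M *m X)) MXM subrr.
have Ce : C *m extend0 e = 0.
  rewrite -mul_colsE; apply/dot_eq0/eqP; rewrite eq_le dot_ge0 andbT.
  rewrite -(pmulr_rle0 _ kap_gt0) (le_trans (D_pos _)) // -dot_trmxr !mulmxA -/M.
  by rewrite Me dot0r.
(* First-order optimality of [w] in the direction of the fit, against the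
   orthogonality of the fit to the kernel of [M], to which [e] belongs. *)
have := min_norm_dir (ltW p0) wmin Ce.
rewrite -{3}wE dot_extend0 subvec_extend0 => h.
have ue : 0 <= dot u e.
  apply: h => i /eqP w0; rewrite extend0_out ?normr0 ?mulr0 //.
  by rewrite inE negbK -sE signv_eq0.
have Xe : dot (X *m (M *m u)) e = 0.
  rewrite mulmxA -XMt dot_trmx mulmxBr (mulmxA X M u).
  rewrite (mulmxA (X *m M) (X *m M)) (mulmxA (X *m M) X) XMX.
  by rewrite subrr dot0r.
have : dot e e = 0.
  apply/eqP; rewrite eq_le dot_ge0 andbT {1}/e dotDl dotNl Xe.
  by rewrite sub0r oppr_le0.
move/dot_eq0/eqP; rewrite subr_eq0 => /eqP ->; exact: esym wE.
Qed.

Lemma cellZ s c p : 0 < c -> cell s p -> cell s (c *: p).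
Proof.
move=> c0 [p0 sp]; have cp : 0 < (c *: p).2 by rewrite /= pmulr_rgt0.
have [kw wmin] := solP p0.
suff e : sol (c *: p) = c *: sol p.
  by split=> //; rewrite e -sp; apply/colP => i; rewrite !mxE sgrM gtr0_sg ?mul1r.
apply: sol_eq => //; split=> [|v kv]; first exact: kktZ.
have ci : 0 < c^-1 by rewrite invr_gt0.
have : kktCD p (c^-1 *: v).
  have := kktZ ci kv; by rewrite scalerA mulVf ?gt_eqF // scale1r.
move=> /wmin; rewrite !ler_l2norm !dotZl !dotZr => h.
have := ler_wpM2l (sqr_ge0 c) h.
by rewrite expr2 !mulrA mulfK ?gt_eqF // mulfV ?gt_eqF // mul1r.
Qed.

(** If [w] and [v] are the minimum-norm solutions at [p] and [q] and share
    their sign vector, every feasible direction of [w + v] at [p + q] is one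
    of [w] at [p] and of [v] at [q]. *)
Lemma cellD s p q : cell s p -> cell s q ->
  cell s (p + q) /\ sol (p + q) = sol p + sol q.
Proof.
move=> sp sq; have [p0 sE] := sp; have [q0 sF] := sq.
have fw := cell_fits sp; have fv := cell_fits sq.
have wmin := solP p0; have vmin := solP q0.
set w := sol p in sE fw wmin *; set v := sol q in sF fv vmin *.
have pq0 : 0 < (p + q).2 by exact: addr_gt0.
have [kwv _ _] := fitsD (ltW p0) (ltW q0) fw fv.
suff e : sol (p + q) = w + v.
  split=> //; split=> //; rewrite e; apply/colP => i.
  have := congr1 (fun x : 'cV[R]_N => x i ord0) sE.
  have := congr1 (fun x : 'cV[R]_N => x i ord0) sF.
  rewrite !mxE => <-; exact: sgrD_eq.
apply: sol_eq => //; split=> // x kx.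
pose h := x - (w + v).
have Cx : C *m x = C *m (w + v) := kkt_eqC kap_gt0 D_pos kx kwv.
have Ch : C *m h = 0 by rewrite mulmxBr Cx subrr.
have wv0 i : (w i ord0 == 0) = (v i ord0 == 0).
  by rewrite -(signv_eq0 w) -(signv_eq0 v) sE sF.
have hx i : w i ord0 = 0 -> h i ord0 = x i ord0.
  move=> w0; have /eqP v0 : v i ord0 == 0 by rewrite -wv0 w0.
  by rewrite !mxE w0 v0 addr0 subr0.
have [kw _ _] := fw; have [kv _ _] := fv.
have bw := mul_coord_le x kw.1; have bv := mul_coord_le x kv.1.
have both i : w i ord0 = 0 ->
    residCD p.1 w i ord0 * x i ord0 = p.2 * `|x i ord0| /\
    residCD q.1 v i ord0 * x i ord0 = q.2 * `|x i ord0|.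
  move=> w0; have /l1_subgradP/(_ i) [_] := kx.
  rewrite (resid_eqC _ _ Cx) residD mxE /= !mulrDl; have := bw i; have := bv i.
  lra.
have dw : 0 <= dot w h.
  apply: (min_norm_dir (ltW p0) wmin Ch) => i w0; rewrite hx //.
  by have [] := both i w0.
have dv : 0 <= dot v h.
  apply: (min_norm_dir (ltW q0) vmin Ch) => i /eqP v0.
  have w0 : w i ord0 = 0 by apply/eqP; rewrite wv0.
  by rewrite hx //; have [] := both i w0.
have : 0 <= dot (w + v) h by rewrite dotDl addr_ge0.
have -> : x = (w + v) + h by rewrite addrC subrK.
clearbody h; rewrite ler_l2norm; move: (w + v) => y.
rewrite !(dotDl, dotDr) (dotC h y).
have := dot_ge0 h; lra.
Qed.

End Cells.
(** * Topology of convex cones *)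

Section ConeTopology.
Variables (R : realType) (V : normedModType R).
Implicit Types (p q d x : V) (A U J : set V).

Lemma nbhs_line p d U : nbhs p U ->
  exists2 T : R, 0 < T & forall t, `|t| <= T -> U (p + t *: d).
Proof.
move=> /nbhs_normP[e /= e0 eU].
have d1 : 0 < `|d| + 1 by rewrite ltr_wpDl.
exists (e / (`|d| + 1)) => [|t tT]; first exact: divr_gt0.
apply: eU; rewrite /= opprD addNKr normrN normrZ.
apply: le_lt_trans (ler_wpM2r (normr_ge0 _) tT) _.
by rewrite -mulrA gtr_pMr // mulrC ltr_pdivrMr // mul1r ltrDl.
Qed.

Lemma closure_of_ray A p q : (forall t, 0 < t -> A (p + t *: q)) -> closure A p.
Proof.
move=> Apq B /(nbhs_line q)[T T0 TB]; exists (p + T *: q); split; first exact: Apq.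
by apply: TB; rewrite gtr0_norm.
Qed.

Lemma segment_image_connected p q :
  connected [set p + t *: (q - p) | t in `[0, 1]%classic].
Proof.
apply: connected_continuous_connected; first exact: segment_connected.
apply: continuous_subspaceT => t; apply: cvgD; first exact: cvg_cst.
by apply: cvgZr_tmp; exact: cvg_id.
Qed.

(** The ball is convex, so a sign change of [l] would produce a zero inside. *)
Lemma sg_const_on_ball (l : V -> R) p (e : R) :
  (forall t a b, l (t *: a + b) = t * l a + l b) -> 0 < e ->
  (forall x, `|p - x| < e -> l x = 0 -> forall d, l d = 0) ->
  forall x, `|p - x| < e -> Num.sg (l x) = Num.sg (l p).
Proof.
move=> lin e0 lz x px.
have pp : `|p - p| < e by rewrite subrr normr0.
(* Where [l] changes sign on the segment it vanishes at an explicit point. *)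
have cross : l x * l p <= 0 -> l p = 0 /\ l x = 0.
  have [d0|d0] := eqVneq (l p - l x) 0.
    move/eqP: d0; rewrite subr_eq0 => /eqP ->; rewrite -expr2 => h.
    have : l x ^+ 2 == 0 by rewrite eq_le h sqr_ge0.
    by rewrite sqrf_eq0 => /eqP.
  move=> h; pose t := l p / (l p - l x); pose y := t *: (x - p) + p.
  have h2 : 0 < (l p - l x) ^+ 2 by rewrite lt_neqAle eq_sym sqrf_eq0 d0 sqr_ge0.
  have t0 : 0 <= t.
    have -> : t = (l p * (l p - l x)) / (l p - l x) ^+ 2 by rewrite /t; field.
    by rewrite divr_ge0 ?(ltW h2) //; have := sqr_ge0 (l p); lra.
  have t1 : t <= 1.
    have -> : t = 1 - (- (l x * (l p - l x))) / (l p - l x) ^+ 2 by rewrite /t; field.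
    rewrite gerBl divr_ge0 ?(ltW h2) //; have := sqr_ge0 (l x); lra.
  have yl : l y = 0.
    rewrite lin (_ : x - p = (-1) *: p + x) ?lin; last by rewrite scaleN1r addrC.
    by rewrite /t; field.
  have py : `|p - y| < e.
    rewrite /y opprD addrCA subrr addr0 normrN normrZ ger0_norm // distrC.
    exact: le_lt_trans (ler_piMl (normr_ge0 _) t1) px.
  by split; exact: lz py yl _.
have : ~~ (l x * l p <= 0) \/ l x * l p <= 0 by case: leP; [right|left].
case=> [|/cross[-> ->] //]; rewrite -ltNge => h.
case: (sgrP (l p)) h => [->|h|h]; first by rewrite mulr0 ltxx.
  by rewrite pmulr_lgt0 // => /gtr0_sg.
by rewrite nmulr_lgt0 // => /ltr0_sg.
Qed.

Section Cone.
Variable J : set V.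
Hypothesis JD : forall p q, J p -> J q -> J (p + q).
Hypothesis JZ : forall (c : R) p, 0 < c -> J p -> J (c *: p).

Lemma cone_interiorD p q : J p -> J° q -> J° (p + q).
Proof.
move=> Jp /nbhs_normP[e e0 eJ]; apply/nbhs_normP; exists e => // x /= xe.
rewrite -(subrK p x) addrC; apply: JD => //; apply: eJ => /=.
by rewrite opprB addrCA addrA.
Qed.

Lemma cone_interiorZ (c : R) p : 0 < c -> J° p -> J° (c *: p).
Proof.
move=> c0 /nbhs_normP[e /= e0 eJ]; apply/nbhs_normP; exists (c * e) => /=.
  exact: mulr_gt0.
move=> x /= xe.
have -> : x = c *: (c^-1 *: x) by rewrite scalerA mulfV ?gt_eqF ?scale1r.
apply: JZ => //; apply: eJ => /=.
rewrite -(ltr_pM2l c0) -{1}(gtr0_norm c0) -normrZ scalerBr scalerA.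
by rewrite mulfV ?gt_eqF ?scale1r.
Qed.

(** Absorb the distance from [p] to a nearby point [x] of [J] into [q]. *)
Lemma cone_closureD p q : closure J p -> J° q -> J° (p + q).
Proof.
move=> Jp /nbhs_normP[e /= e0 eJ].
have [] := Jp (ball p (e / 2)); first by apply: nbhsx_ballx; exact: divr_gt0.
move=> x [Jx]; rewrite -ball_normE /= => px.
have -> : p + q = x + (q + (p - x)) by rewrite addrCA (addrC x) subrK addrC.
apply: cone_interiorD => //; apply/nbhs_normP.
exists (e / 2) => /=; first exact: divr_gt0.
move=> y /= ye; apply: eJ => /=.
have -> : q - y = (q + (p - x) - y) - (p - x).
  by rewrite [RHS]addrAC addrK.
by rewrite (le_lt_trans (ler_normB _ _)) // [e]splitr ltrD.
Qed.

Lemma cone_closure_interior p q : closure J p -> J° q -> closure J° p.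
Proof.
move=> Jp Jq; apply: (@closure_of_ray _ _ q) => t t0.
by apply: cone_closureD => //; exact: cone_interiorZ.
Qed.

(** This description of the closure, which mentions no limit, makes it evident
    that the closure is a cone. *)
Lemma cone_closure_interiorP p : J° !=set0 ->
  closure J° p <-> forall q, J° q -> J° (p + q).
Proof.
move=> [q0 Jq0]; split=> [Jp q Jq|h].
  by apply: cone_closureD => //; apply: closureS Jp; exact: interior_subset.
by apply: (@closure_of_ray _ _ q0) => t t0; apply: h; exact: cone_interiorZ.
Qed.

(** Step back from [p] along an interior direction, staying in the closure, and
    return. *)
Lemma cone_interior_closure : J° !=set0 -> (closure J°)° `<=` J°.
Proof.
move=> [q Jq] p /(nbhs_line (- q))[T T0 /(_ T)].
rewrite gtr0_norm // => /(_ (lexx T)).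
move=> /(closureS (@interior_subset _ J)) h.
by have := cone_closureD h (cone_interiorZ T0 Jq); rewrite scalerN subrK.
Qed.

Lemma cone_interior_connected : connected J°.
Proof.
have [[p Jp]|/set0P/negP] := pselect (J° !=set0); last first.
  by rewrite negbK => /eqP ->; exact: connected0.
have -> : J° = \bigcup_(q in J°) [set p + t *: (q - p) | t in `[0, 1]%classic].
  apply/seteqP; split=> [q Jq|_ [q Jq [t /= + <-]]].
    exists q => //; exists 1; first by rewrite /= in_itv /= ler01 lexx.
    by rewrite scale1r addrC subrK.
  rewrite in_itv /= => /andP[]; rewrite !le_eqVlt => /orP[/eqP <- _|t0].
    by rewrite scale0r addr0.
  case/orP=> [/eqP ->|t1]; first by rewrite scale1r addrC subrK.
  have -> : p + t *: (q - p) = (1 - t) *: p + t *: q.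
    by rewrite scalerBr scalerBl scale1r addrA addrAC.
  apply: cone_interiorD; last exact: cone_interiorZ.
  by apply: JZ; [rewrite subr_gt0|exact: interior_subset].
apply: bigcup_connected => [|q _]; last exact: segment_image_connected.
exists p => q _; exists 0; first by rewrite /= in_itv /= ler01 lexx.
by rewrite scale0r addr0.
Qed.

End Cone.
End ConeTopology.
(** * The linear zones are the closures of the open sign cells *)

Section Zones.
Variables (R : realType) (k N : nat) (C : 'M[R]_(k, N)) (D : 'M[R]_k).
Variable kap : R.
Hypothesis kap_gt0 : 0 < kap.
Hypothesis D_pos : forall v : 'cV[R]_k, kap * dot v v <= dot v (D *m v).
Variable sol : 'cV[R]_k * R -> 'cV[R]_N.
Hypothesis solP : forall p, 0 < p.2 -> is_min_norm [set w | kkt C D p w] (sol p).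
Implicit Types (w v s : 'cV[R]_N) (p q : 'cV[R]_k * R).

Local Notation cell := (cell sol).
Local Notation dom := (@param_dom R k).
Local Notation fits := (fits C D).
Local Notation eq_fit := (eq_fit C D).

Lemma eq_fit_linear s : exists L : {linear ('cV[R]_k * R)%type -> 'cV[R]_N},
  forall p, L p = eq_fit s p.
Proof.
have lin : linear (eq_fit s) by move=> t p q; exact: eq_fitZD.
pose L : {linear ('cV[R]_k * R)%type -> 'cV[R]_N} :=
  HB.pack (eq_fit s) (GRing.isLinear.Build _ _ _ _ (eq_fit s) lin).
by exists L.
Qed.

(** The formula of a cell extends to the boundary points: a solution [x] at
    such a point [p], perturbed along the solution at an interior point [q],
    stays a solution at [p + t *: q], hence is no shorter than the fit. *)
Lemma cell_boundary s p q : 0 < p.2 -> cell s q ->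
  (forall t, 0 < t -> cell s (p + t *: q)) ->
  fits s p (eq_fit s p) /\ sol p = eq_fit s p.
Proof.
move=> p0 sq spq; have [q0 _] := sq.
have solE t : 0 < t -> sol (p + t *: q) = eq_fit s p + t *: sol q.
  move=> t0; rewrite (cell_eq_fit kap_gt0 D_pos solP (spq t t0)).
  by rewrite (cell_eq_fit kap_gt0 D_pos solP sq) addrC eq_fitZD addrC.
set w := eq_fit s p in solE *; set v := sol q in solE *.
have fv : fits s q v := cell_fits solP sq.
have fw : fits s p w.
  apply: (@fits_limit _ _ _ C D s p q w v) => t t0.
  by have := cell_fits solP (spq t t0); rewrite solE // (addrC p) (addrC w).
split=> //; apply: (sol_eq kap_gt0 D_pos solP) => //.
have [kw _ _] := fw; have [kv _ _] := fv.
split=> // x kx; have Cx := kkt_eqC kap_gt0 D_pos kx kw.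
have xpos t : 0 < t -> 0 <= (dot x x - dot w w) + t * (2 * dot x v - 2 * dot w v).
  move=> t0; have tq0 : 0 < (t *: q).2 by exact: mulr_gt0.
  have ft := fitsZ t0 fv; have [kt _ _] := ft.
  have kxt : kkt C D (p + t *: q) (x + t *: v).
    apply: kktD => //; [exact: ltW|exact: ltW| |].
      by rewrite (resid_eqC _ _ Cx) (fits_dot fw ft).
    rewrite dot_resid Cx -dot_resid (fits_dot ft fw).
    by rewrite (kkt_l1norm kap_gt0 D_pos p0 kx kw).
  have [_ /(_ _ kxt)] := solP (spq t t0).1.
  rewrite solE // ler_l2norm !(dotDl, dotDr, dotZl, dotZr) (dotC v x) (dotC v w).
  lra.
rewrite ler_l2norm -subr_ge0.
by apply: (ge0_of_small (T := 1)) => [//|t /andP[t0 _]]; exact: xpos.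
Qed.

(** If solutions are unique, [eq_fit s p + sol q] is the solution at [p + q]; the
    second term has sign [s] and the first one cannot oppose it. *)
Lemma fits_add_cell s p q :
  (forall p' w' v', 0 < p'.2 -> kkt C D p' w' -> kkt C D p' v' -> w' = v') ->
  0 < p.2 -> fits s p (eq_fit s p) -> cell s q -> cell s (p + q).
Proof.
move=> uniq p0 fw sq; have [q0 sv] := sq; have fv := cell_fits solP sq.
have pq0 : 0 < (p + q).2 by exact: addr_gt0.
have [kwv _ _] := fitsD (ltW p0) (ltW q0) fw fv.
have [kpq _] := solP pq0; split=> //; rewrite (uniq _ _ _ pq0 kpq kwv).
apply/colP => i; have [_ _ /(_ i)] := fw.
have := congr1 (fun x : 'cV[R]_N => x i ord0) sv; rewrite !mxE => <- {fw kwv}.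
move: (eq_fit s p i ord0) (sol q i ord0) => a b.
case: (sgrP b) => [->|b0|b0]; rewrite ?mul0r ?mul1r ?mulN1r.
- by move=> /esym/normr0_eq0 ->; rewrite addr0 sgr0.
- by move=> a0; rewrite gtr0_sg // ltr_wpDl // a0.
- move=> /(congr1 -%R); rewrite opprK => a0; rewrite ltr0_sg //.
  by rewrite -oppr_gt0 opprD ltr_wpDl ?oppr_gt0 // a0 opprK.
Qed.

(** Where [sol] is linear near [p], a component vanishing at [p] vanishes
    identically: otherwise it takes both signs near [p], and the residual, which
    is affine along a line, would jump there from [- p.2] to [p.2]. *)
Lemma linear_piece_vanish (L : {linear ('cV[R]_k * R)%type -> 'cV[R]_N}) p i :
  (\forall q \near p, 0 < q.2 /\ sol q = L q) ->
  L p i ord0 = 0 -> forall d, L d i ord0 = 0.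
Proof.
move=> near_p Lp d; apply/eqP; apply/negPn/negP => Ld.
wlog Ld0 : d Ld / 0 < L d i ord0.
  move=> h; case: (ltrgt0P (L d i ord0)) (Ld) => // Ld0 _; first exact: h Ld Ld0.
  by apply: (h (- d)); rewrite linearN mxE ?oppr_eq0 ?oppr_gt0.
have [T T0 TP] := nbhs_line d near_p.
have line t : L (p + t *: d) i ord0 = t * L d i ord0.
  by rewrite linearD linearZ !mxE Lp add0r.
pose a := resid C D p.1 (L p) i ord0; pose c := resid C D d.1 (L d) i ord0.
have res t : `|t| <= T -> t != 0 -> a + t * c = Num.sg t * (p.2 + t * d.2).
  move=> tT t0; have [q0 solq] := TP t tT; have [kq _] := solP q0.
  have [_ /(_ i) + _] := kkt_fits kq; rewrite signv_eq0 solq line.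
  rewrite mulf_eq0 negb_or t0 gt_eqF // => /(_ isT).
  have -> : resid C D (p + t *: d).1 (L (p + t *: d)) =
      t *: resid C D d.1 (L d) + resid C D p.1 (L p).
    by rewrite (addrC p) (linearP L) /= residZD.
  have -> : (t *: resid C D d.1 (L d) + resid C D p.1 (L p)) i ord0 = t * c + a.
    by rewrite /a /c; move: (resid _ _ d.1 _) (resid _ _ p.1 _) => x y; rewrite !mxE.
  rewrite [signv _ _ _]mxE line sgrM (gtr0_sg Ld0) mulr1 => e.
  by rewrite addrC e mulrC.
(* Two step lengths on each side eliminate the slopes [c] and [d.2]. *)
have h1 := res T; have h2 := res (- T).
have h3 := res (T / 2); have h4 := res (- (T / 2)).
have T2 : 0 < T / 2 by exact: divr_gt0.
have T2T : T / 2 <= T by lra.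
move: h1 h2 h3 h4; rewrite !normrN (gtr0_norm T0) (gtr0_norm T2) T2T lexx.
rewrite !oppr_eq0 !gt_eqF // !sgrN (gtr0_sg T0) (gtr0_sg T2).
move=> /(_ isT isT) h1 /(_ isT isT) h2 /(_ isT isT) h3 /(_ isT isT) h4.
have [p0 _] := nbhs_singleton near_p.
lra.
Qed.

(** In a ball where [sol] is linear, no component changes sign: it would vanish
    somewhere on the way, hence everywhere. *)
Lemma locally_linear_cell p : locally_linear_pts sol p -> (cell (signv (sol p)))° p.
Proof.
move=> [U [pU Udom [L LU]]]; have /nbhs_normP[e /= e0 eU] := pU.
have near_x x : `|p - x| < e -> \forall q \near x, 0 < q.2 /\ sol q = L q.
  move=> px; have : nbhs x (ball p e).
    by apply: open_nbhs_nbhs; split; [exact: ball_open|rewrite -ball_normE].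
  apply: filterS => q; rewrite -ball_normE => /eU Uq.
  by split; [exact: Udom|exact: LU].
suff : nbhs p (cell (signv (sol p))) by [].
apply/nbhs_ballP; exists e => // x; rewrite -ball_normE /= => px.
have [x0 solx] := nbhs_singleton (near_x x px).
have pp : `|p - p| < e by rewrite subrr normr0.
have [_ solp] := nbhs_singleton (near_x p pp).
split=> //; apply/colP => i; rewrite !mxE solx solp.
apply: (@sg_const_on_ball _ _ (fun y => L y i ord0) p e) => //.
  by move=> t a b; rewrite linearD linearZ !mxE.
by move=> y py Ly d; apply: linear_piece_vanish Ly d; exact: near_x.
Qed.

Lemma cell_open_linear s p : (cell s)° p -> locally_linear_pts sol p.
Proof.
move=> sp; exists (cell s); split=> //; first by move=> q [].
have [L LE] := eq_fit_linear s.
by exists L => q sq; rewrite LE (cell_eq_fit kap_gt0 D_pos solP sq).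
Qed.

Let cellZ s (c : R) p : 0 < c -> cell s p -> cell s (c *: p).
Proof. exact: (cellZ kap_gt0 D_pos solP). Qed.

Lemma cell_add s p q : cell s p -> cell s q -> cell s (p + q).
Proof. by move=> sp sq; have [] := cellD kap_gt0 D_pos solP sp sq. Qed.

(** The open cells are convex, pairwise disjoint, and make up the whole set of
    points of local linearity, so each is clopen in a component that meets it. *)
Lemma component_cell s p : (cell s)° p ->
  connected_component (locally_linear_pts sol) p = (cell s)°.
Proof.
move=> sp; apply/seteqP; split; last first.
  apply: connected_component_max => //; first by move=> q; exact: cell_open_linear.
  by apply: cone_interior_connected; [exact: cell_add|exact: cellZ].
set Q := connected_component _ p.
have pQ : Q p by apply: connected_component_refl; exact: cell_open_linear sp.
suff <- : Q `&` (cell s)° = Q by exact: subIsetr.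
apply: component_connected.
- by exists p.
- by exists (cell s)° => //; exact: open_interior.
exists (~` \bigcup_(s' in [set s' | s' != s]) (cell s')°).
  by apply: open_closedC; apply: bigcup_open => s' _; exact: open_interior.
apply/seteqP; split=> q [Qq sq]; split=> //.
  move=> [s' /= /eqP s's /interior_subset [_ s'q]].
  by case/interior_subset: sq => _ sq; apply: s's; rewrite -s'q.
have := locally_linear_cell (connected_component_sub Qq).
have [<- //|ne] := eqVneq (signv (sol q)) s.
by move=> h; case: sq; exists (signv (sol q)).
Qed.

Lemma linear_zonesP Z : linear_zones sol Z <->
  exists2 s, (cell s)° !=set0 & Z = closure (cell s)° `&` dom.
Proof.
split=> [[p pO ->]|[s [p sp] ->]].
  have sp := locally_linear_cell pO; exists (signv (sol p)); first by exists p.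
  by rewrite (component_cell sp).
exists p; first exact: cell_open_linear sp.
by rewrite (component_cell sp).
Qed.

Lemma interior_zone s : (cell s)° !=set0 ->
  (closure (cell s)° `&` dom)° = (cell s)°.
Proof.
move=> s0; apply/seteqP; split.
  rewrite interiorI => p [+ _].
  by apply: cone_interior_closure => //; [exact: cell_add|exact: cellZ].
rewrite -open_subsetE; last exact: open_interior.
by move=> p sp; split; [exact: subset_closure|case/interior_subset: sp].
Qed.

Lemma zoneP s p : (cell s)° !=set0 ->
  (closure (cell s)° `&` dom) p <->
  0 < p.2 /\ forall q, (cell s)° q -> (cell s)° (p + q).
Proof.
move=> s0; have h := cone_closure_interiorP (@cell_add s) (@cellZ s) p s0.
by split=> [[/h]|[? /h]].
Qed.

Lemma zone_fits s p : (cell s)° !=set0 -> (closure (cell s)° `&` dom) p ->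
  fits s p (eq_fit s p) /\ sol p = eq_fit s p.
Proof.
move=> s0 /(zoneP p s0)[p0 ps]; have [q sq] := s0.
apply: (cell_boundary p0 (interior_subset sq)) => t t0.
apply: interior_subset; apply: ps; apply: cone_interiorZ => //.
exact: cellZ.
Qed.

Lemma zone_convex_cone s : (cell s)° !=set0 ->
  convex_cone (closure (cell s)° `&` dom).
Proof.
move=> s0 n c v c0 [i0 ci0] vZ.
have vP i := (zoneP (v i) s0).1 (vZ i).
have step i q : 0 <= c i -> (cell s)° q -> (cell s)° (c i *: v i + q).
  rewrite le_eqVlt => /orP[/eqP <-|ci] sq; first by rewrite scale0r add0r.
  have Zi t x : 0 < t -> (cell s)° x -> (cell s)° (t *: x).
    by move=> t0; apply: cone_interiorZ => //; exact: cellZ.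
  have ci1 : 0 < (c i)^-1 by rewrite invr_gt0.
  have := Zi _ _ ci ((vP i).2 _ (Zi _ _ ci1 sq)).
  by rewrite scalerDr scalerA mulfV ?gt_eqF ?scale1r.
apply/(zoneP _ s0); split.
  rewrite (raddf_sum (@snd 'cV[R]_k R)) /=; rewrite (bigD1 i0) //=.
  rewrite ltr_pwDl ?mulr_gt0 //.
  - by rewrite lt_neqAle eq_sym ci0 c0.
  - by have [] := vP i0.
  - by apply: sumr_ge0 => i _; rewrite mulr_ge0 // ltW //; have [] := vP i.
move=> q sq; elim/big_rec: _ => [|i x _ IH]; first by rewrite add0r.
by rewrite -addrA; exact: step.
Qed.

End Zones.
(** * Finitely many cells cover the parameter space *)

Lemma infinite_fiber (T : finType) (f : nat -> T) :
  exists t, infinite_set (f @^-1` [set t]).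
Proof.
apply: contrapT => /forallNP h; apply: infinite_nat.
rewrite (_ : setT = \bigcup_(t in [set: T]) (f @^-1` [set t])).
  by apply: bigcup_finite => [|t _]; [exact: finite_finset|exact: contrapT (h t)].
by apply/seteqP; split=> // j _; exists (f j).
Qed.

Lemma infinite_set_seq (A : set nat) n : infinite_set A ->
  exists s : seq nat, [/\ uniq s, size s = n & forall j, j \in s -> A j].
Proof.
move=> Ainf; elim: n => [|n [s [us ss sA]]]; first by exists [::].
have [j Aj js] : exists2 j, A j & j \notin s.
  apply: contrapT => h; apply: Ainf; apply: (sub_finite_set _ (finite_seq s)).
  by move=> j Aj /=; apply: contrapT => /negP js; apply: h; exists j.
exists (j :: s); split; rewrite /= ?js ?ss // => l.
by rewrite inE => /orP[/eqP ->|/sA].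
Qed.

Section ConeInterior.
Variables (R : realType) (k : nat).
Implicit Types x p : 'cV[R]_k * R.

Definition param_row x : 'rV[R]_(k + 1) := row_mx x.1^T x.2%:M.

Lemma param_rowl x l : param_row x ord0 (lshift 1 l) = x.1 l ord0.
Proof. by rewrite row_mxEl mxE. Qed.

Lemma param_rowr x l : param_row x ord0 (rshift k l) = x.2.
Proof. by rewrite row_mxEr mxE (ord1 l) eqxx mulr1n. Qed.

Lemma continuous_param_row j : continuous (fun x => param_row x ord0 j).
Proof.
rewrite -(splitK j); case: (fintype.split j) => l /=.
  under eq_fun do rewrite param_rowl.
  move=> x; apply: (@continuous_comp _ _ _ (fun y : 'cV[R]_k * R => y.1)
    (fun M : 'cV[R]_k => M l ord0)).
    exact: cvg_fst.
  exact: coord_continuous.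
under eq_fun do rewrite param_rowr.
by move=> x; exact: cvg_snd.
Qed.

(** The points with positive coordinates in a basis form a nonempty open set. *)
Lemma cone_interior_of_basis (J : set ('cV[R]_k * R))
    (u : 'I_(k + 1) -> 'cV[R]_k * R) :
  (forall p q, J p -> J q -> J (p + q)) ->
  (forall (c : R) p, 0 < c -> J p -> J (c *: p)) ->
  (forall i, J (u i)) -> (\matrix_i param_row (u i)) \in unitmx -> J° !=set0.
Proof.
move=> JD JZ Ju uQ; set Q := \matrix_i _ in uQ.
pose c x := param_row x *m invmx Q.
have cE x : x = \sum_i c x ord0 i *: u i.
  have rE : param_row x = \sum_i c x ord0 i *: param_row (u i).
    rewrite -[LHS](mulmxKV uQ) mulmx_sum_row; apply: eq_bigr => i _.
    by rewrite rowK.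
  have rE' j : param_row x ord0 j = \sum_i c x ord0 i * param_row (u i) ord0 j.
    by rewrite {1}rE summxE; apply: eq_bigr => i _; rewrite mxE.
  rewrite [LHS]surjective_pairing [RHS]surjective_pairing.
  rewrite (raddf_sum (@fst 'cV[R]_k R)) (raddf_sum (@snd 'cV[R]_k R)) /=.
  congr pair.
    apply/colP => l; have := rE' (lshift 1 l).
    rewrite param_rowl summxE => ->; apply: eq_bigr => i _.
    by rewrite param_rowl [RHS]mxE.
  have := rE' (rshift k ord0); rewrite param_rowr => ->.
  by apply: eq_bigr => i _; congr (_ * _); rewrite param_rowr.
have cc i : continuous (fun x => c x ord0 i).
  rewrite (_ : (fun x => _) =
      fun x => \sum_j param_row x ord0 j * invmx Q j i); last first.
    by apply/funext => x; rewrite mxE.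
  apply: continuous_sum => j x; apply: cvgM; last exact: cvg_cst.
  exact: continuous_param_row.
pose x0 := \sum_i u i.
have c1 i : c x0 ord0 i = 1.
  have -> : c x0 = const_mx 1; last by rewrite mxE.
  rewrite /c; have -> : param_row x0 = const_mx 1 *m Q; last by rewrite mulmxK.
  have QE i' j : Q i' j = param_row (u i') ord0 j by rewrite mxE.
  apply/rowP => j; rewrite [RHS]mxE.
  under eq_bigr => l _ do rewrite [const_mx _ _ _]mxE mul1r QE.
  rewrite -(splitK j); case: (fintype.split j) => l /=.
    rewrite param_rowl (raddf_sum (@fst 'cV[R]_k R)) summxE.
    by apply: eq_bigr => l' _; rewrite -param_rowl.
  rewrite param_rowr (raddf_sum (@snd 'cV[R]_k R)).
  by apply: eq_bigr => l' _; rewrite -[LHS](param_rowr _ l).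
exists x0; suff : \forall x \near x0, forall i, 0 < c x ord0 i.
  apply: filterS => x c0; suff : J (\sum_i c x ord0 i *: u i) by rewrite -cE.
  have Jc i : J (c x ord0 i *: u i) by exact: JZ.
  have Jsum (r : seq 'I_(k + 1)) y : J y -> J (y + \sum_(i <- r) c x ord0 i *: u i).
    move=> Jy; elim/big_rec: _ => [|i z _ Jz]; first by rewrite addr0.
    by rewrite addrCA; exact: JD.
  by rewrite (bigD1 (rshift k ord0)) //= -big_filter; exact: Jsum.
apply: (@filter_forall _ _ (fun i x => 0 < c x ord0 i) _ (nbhs_filter x0)) => i.
have : \forall y \near c x0 ord0 i, 0 < y by rewrite c1; exact: lt_nbhsr.
by move/(cc i x0).
Qed.

(** Distinct points of this moment curve, lifted to height [p.2 != 0], are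
    linearly independent: a vanishing linear functional is a polynomial of
    degree at most [k] in the parameter, with [k + 1] roots. *)
Definition moment_point p (th : R) : 'cV[R]_k * R :=
  (p.1 + \col_i th ^+ i.+1, p.2).

Lemma moment_points_unitmx p (th : 'I_(k + 1) -> R) : p.2 != 0 -> injective th ->
  (\matrix_i param_row (moment_point p (th i))) \in unitmx.
Proof.
move=> p0 th_inj; set Q := \matrix_i _.
rewrite -unitmx_tr -row_free_unit; apply: inj_row_free => v vQ.
pose f l := v ord0 (lshift 1 l); pose g := v ord0 (rshift k ord0).
(* The value of the functional [v] at the curve, as a polynomial in the
   parameter: the curve starts with the power [1], and the constant coefficient
   collects the contributions of [p]. *)
pose r : {poly R} := \poly_(j < k.+1)
  if j is j'.+1 then (if insub j' is Some l then f l else 0)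
  else \sum_l f l * p.1 l ord0 + g * p.2.
have rz i : root r (th i).
  have : (v *m Q^T) ord0 i = 0 by rewrite vQ mxE.
  have QE j : Q^T j i = param_row (moment_point p (th i)) ord0 j.
    by rewrite mxE [LHS]mxE.
  rewrite mxE big_split_ord /= big_ord1 !QE param_rowr => h.
  apply/eqP; rewrite horner_poly -[RHS]h big_ord_recl /= expr0 mulr1 addrAC.
  congr (_ + _); rewrite -big_split /=; apply: eq_bigr => l _.
  rewrite /bump /= add1n valK QE param_rowl -mulrDr; congr (_ * _).
  by rewrite /= !mxE.
have r0 : r = 0.
  apply: (@roots_geq_poly_eq0 _ _ [seq th i | i <- enum 'I_(k + 1)]).
  - by apply/allP => x /mapP[i _ ->]; exact: rz.
  - by rewrite map_inj_uniq ?enum_uniq.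
  - by rewrite size_map size_enum_ord addn1 size_poly.
have f0 l : f l = 0.
  have := congr1 (fun q : {poly R} => q`_l.+1) r0.
  by rewrite coef_poly ltnS ltn_ord valK coef0.
have g0 : g = 0.
  have := congr1 (fun q : {poly R} => q`_0) r0.
  rewrite coef_poly coef0 big1 => [|l _]; last by rewrite f0 mul0r.
  by rewrite add0r => /eqP; rewrite mulf_eq0 (negbTE p0) orbF => /eqP.
apply/rowP => j; rewrite mxE -(splitK j); case: (fintype.split j) => l /=.
  exact: f0.
by rewrite ord1.
Qed.

Lemma moment_point_near p U : nbhs p U ->
  exists e : R, 0 < e /\ forall th, 0 < th -> th < e -> U (moment_point p th).
Proof.
move=> /nbhs_ballP[e e0 eU]; exists (Num.min e 1); rewrite lt_min e0 ltr01.
split=> // th th0; rewrite lt_min => /andP[the th1]; apply: eU.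
split; last exact: ballxx.
split=> // i j; rewrite -ball_normE /= !mxE !ord1 opprD addNKr normrN.
rewrite gtr0_norm ?exprn_gt0 //.
by apply: le_lt_trans the; rewrite exprS ler_piMr ?(ltW th0) // exprn_ile1 ?ltW.
Qed.

End ConeInterior.
Definition sign_decode (R : realType) N (t : {ffun 'I_N -> 'I_3}) : 'cV[R]_N :=
  \col_i ((t i)%:R - 1).

Lemma sign_decode_surj (R : realType) N (w : 'cV[R]_N) :
  exists t, signv w = sign_decode R t.
Proof.
pose t : {ffun 'I_N -> 'I_3} :=
  [ffun i => inord (if w i ord0 < 0 then 0%N else if w i ord0 == 0 then 1%N else 2%N)].
exists t; apply/colP => i; rewrite !mxE ffunE inordK; last first.
  by case: ifP => // _; case: ifP.
case: (ltrgt0P (w i ord0)) => [h|h|->].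
- by rewrite gtr0_sg // -natr1 addrK.
- by rewrite ltr0_sg // sub0r.
- by rewrite sgr0 subrr.
Qed.

Lemma slope_ge0 (R : realDomainType) (sig a c l m t : R) :
  sig * a = l -> sig * (a + t * c) <= l + t * m -> 0 <= t * (m - sig * c).
Proof. by move=> <-; rewrite mulrDr lerD2l mulrCA mulrBr subr_ge0. Qed.

Section Cover.
Variables (R : realType) (k N : nat) (C : 'M[R]_(k, N)) (D : 'M[R]_k).
Variable kap : R.
Hypothesis kap_gt0 : 0 < kap.
Hypothesis D_pos : forall v : 'cV[R]_k, kap * dot v v <= dot v (D *m v).
Variable sol : 'cV[R]_k * R -> 'cV[R]_N.
Hypothesis solP : forall p, 0 < p.2 -> is_min_norm [set w | kkt C D p w] (sol p).
Implicit Types (w v s : 'cV[R]_N) (p q : 'cV[R]_k * R).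

Local Notation cell := (cell sol).
Local Notation dom := (@param_dom R k).

(** Infinitely many points of the moment curve through [p] fall in one cell:
    [k + 1] of them show that this cell has interior points, and the points
    close to [p] show that [p] is adherent to it. *)
Lemma open_cells_cover p : 0 < p.2 ->
  exists2 s, (cell s)° !=set0 & closure (cell s)° p.
Proof.
move=> p0; pose th (j : nat) : R := j.+1%:R^-1.
have th_gt0 j : 0 < th j by rewrite invr_gt0 ltr0Sn.
have th_inj : injective th.
  by move=> i j /invr_inj/eqP; rewrite eqr_nat => /eqP [].
have [code codeP] := choice (@sign_decode_surj R N).
have [t Ainf] := infinite_fiber (fun j => code (sol (moment_point p (th j)))).
set A := _ @^-1` _ in Ainf; pose s := sign_decode R t.
have As j : A j -> cell s (moment_point p (th j)).
  by move=> Aj; split=> //; rewrite codeP Aj.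
have JD := @cell_add R k N C D kap kap_gt0 D_pos sol solP s.
have JZ := @cellZ R k N C D kap kap_gt0 D_pos sol solP s.
have s0 : (cell s)° !=set0.
  have [r [ur sr rA]] := infinite_set_seq (k + 1) Ainf.
  pose u (i : 'I_(k + 1)) := th (nth 0%N r i).
  apply: (cone_interior_of_basis JD JZ (u := fun i => moment_point p (u i))).
    by move=> i; apply/As/rA/mem_nth; rewrite sr.
  apply: moment_points_unitmx; first by rewrite gt_eqF.
  move=> i j /th_inj/eqP; rewrite nth_uniq ?sr //.
  by move/eqP/val_inj.
exists s => //; have [q sq] := s0.
apply: (cone_closure_interior JD JZ) sq => B /moment_point_near[e [e0 eB]].
have [j Aj je] : exists2 j, A j & th j < e.
  have [M Me] := near_infty_natSinv_lt (PosNum e0); move=> Mlt.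
  apply: contrapT => h; apply: Ainf; apply: (sub_finite_set _ (finite_II M)).
  move=> j Aj /=; rewrite ltnNge; apply/negP => Mj; apply: h; exists j => //.
  exact: Mlt.
by exists (moment_point p (th j)); split; [exact: As|exact: eB].
Qed.

Lemma zone_linear s : (cell s)° !=set0 ->
  coincides_linear sol (closure (cell s)° `&` dom).
Proof.
move=> s0.
have [L LE] := eq_fit_linear C D s; exists L => p sp; rewrite LE.
by have [] := zone_fits kap_gt0 D_pos solP s0 sp.
Qed.

Lemma linear_zones_bound : (linear_zones sol #<= `I_(3 ^ N))%card.
Proof.
pose T := {ffun 'I_N -> 'I_3}; pose t0 : T := [ffun=> ord0].
pose F j := closure (cell (sign_decode R (nth t0 (enum T) j)))° `&` dom.
have -> : (3 ^ N = #|T|)%N by rewrite card_ffun !card_ord.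
apply: card_le_trans (card_image_le F _); apply: subset_card_le.
move=> Z /(linear_zonesP kap_gt0 D_pos solP)[s [p sp] ->].
have [_ pE] := interior_subset sp; have [t tE] := sign_decode_surj (sol p).
exists (index t (enum T)); first by rewrite /= cardE index_mem mem_enum.
by rewrite /F nth_index ?mem_enum // -tE pE.
Qed.

Lemma sol_piecewise_linear : piecewise_linear sol.
Proof.
split.
- exact: card_le_finite linear_zones_bound (finite_II _).
- apply/seteqP; split=> [p [Z /(linear_zonesP kap_gt0 D_pos solP)[s _ ->] []//]|p p0].
  have [s s0 sp] := open_cells_cover p0.
  exists (closure (cell s)° `&` dom) => //.
  by apply/(linear_zonesP kap_gt0 D_pos solP); exists s.
- move=> Z /(linear_zonesP kap_gt0 D_pos solP)[s s0 ->]; exact: zone_linear.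
Qed.

Lemma zone_indicatorP s s' : (cell s)° !=set0 ->
  zone_indicator sol (closure (cell s)° `&` dom) s' <-> s' = s.
Proof.
move=> s0; rewrite /zone_indicator (interior_zone kap_gt0 D_pos solP s0).
have [p sp] := s0; split=> [[_ /(_ p sp) ->]|->]; first by case: (interior_subset sp).
split=> [i|q /interior_subset [_ //]].
have [_ <-] := interior_subset sp; rewrite mxE.
by case: sgrP => _; [apply: Or32|apply: Or31|apply: Or33].
Qed.

(** At an interior point of a zone, an index off the support that attains
    [lam] would attain it for all parameters, by linearity; its column would
    then be a combination of the columns of the support. *)
Lemma strict_off_support s p i :
  (forall h : 'cV[R]_N, C *m h = 0 ->
    (forall j, h j ord0 != 0 -> `|resid C D p.1 (sol p) j ord0| = p.2) -> h = 0) ->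
  (cell s)° p -> s i ord0 = 0 -> `|resid C D p.1 (sol p) i ord0| != p.2.
Proof.
move=> indep sp si0; apply/negP => /eqP pi.
have solE q : cell s q -> sol q = eq_fit C D s q.
  exact: (cell_eq_fit kap_gt0 D_pos solP (p := q)).
have ps := interior_subset sp; have [p0 _] := ps.
pose phi q := resid C D q.1 (eq_fit C D s q) i ord0.
have phiD t d : phi (p + t *: d) = phi p + t * phi d.
  rewrite /phi (addrC p) eq_fitZD /= residZD.
  by move: (resid _ _ d.1 _) (resid _ _ p.1 _) => x y; rewrite !mxE addrC.
pose sig := Num.sg (phi p).
have phip : `|phi p| = p.2 by rewrite /phi -solE.
have sig0 : sig != 0 by rewrite sgr_eq0 -normr_eq0 phip gt_eqF.
have sigp : sig * phi p = p.2 by rewrite -normrEsg.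
have sig1 : `|sig| = 1 by rewrite normr_sg -normr_eq0 phip gt_eqF.
(* [q.2 - sig * phi q] is linear, nonnegative on the cell, and zero at [p]. *)
have psi0 d : d.2 = sig * phi d.
  have [T T0 TP] := nbhs_line d sp.
  have ge0 t : `|t| <= T -> 0 <= t * (d.2 - sig * phi d).
    move=> /TP tq; have [q0 _] := tq; have [[/(_ i) + _] _] := solP q0.
    rewrite solE // -/(phi _) phiD => h.
    have {}h : sig * (phi p + t * phi d) <= p.2 + t * d.2.
      by rewrite (le_trans (ler_norm _)) // normrM sig1 mul1r.
    exact: slope_ge0 sigp h.
  have := ge0 T; have := ge0 (- T); rewrite normrN gtr0_norm // lexx mulNr.
  move=> /(_ isT) h1 /(_ isT) h2; apply/eqP; rewrite -subr_eq0.
  have /eqP : T * (d.2 - sig * phi d) = 0.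
    by apply/eqP; rewrite eq_le h2 -oppr_ge0 h1.
  by rewrite mulf_eq0 gt_eqF.
have phi0 b : phi (b, 0) = 0.
  by have /eqP := psi0 (b, 0); rewrite eq_sym mulf_eq0 (negbTE sig0) => /eqP.
set E := supp s; set CE := colsE C E.
set X := MoorePenrose (CE^T *m D *m CE).
pose y := C *m delta_mx i (ord0 : 'I_1).
(* The vanishing of [phi] at all [(b, 0)] says that the transpose of
   [1 - D P] kills the column [y], where [P b] is the image of the fit under
   [C]; spelled out, [y] is the image of [extend0 u]. *)
pose u := X^T *m (CE^T *m (D^T *m y)).
have Cy : y = C *m extend0 u.
  apply/eqP; rewrite -subr_eq0; apply/eqP/dot_eq0; set b := y - _.
  have := phi0 b; rewrite /phi /eq_fit scale0r subr0 -/E -/CE -/X /=.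
  rewrite -(dot_delta (resid _ _ _ _)) dot_resid -/y -(mulmxA D) -mul_colsE -/CE.
  rewrite dotDl dotNl => h.
  rewrite {1}/b -mul_colsE -/CE dotDl dotNl (dotC y) -[RHS]h.
  by congr (_ - _); rewrite -dot_trmxr /u !dot_trmx dotC.
have hj j : (delta_mx i ord0 - extend0 u) j ord0 = (j == i)%:R - extend0 u j ord0.
  by move: (extend0 u) => x; rewrite !mxE eqxx andbT.
have : delta_mx i ord0 - extend0 u = 0 :> 'cV[R]_N.
  apply: indep => [|j]; first by rewrite mulmxBr -Cy subrr.
  rewrite hj; have [-> //|ji] := eqVneq j i.
  have [|jE] := boolP (j \in E); last by rewrite extend0_out // subr0 eqxx.
  rewrite inE => sj _; have [_ /(_ j sj) -> _] := cell_fits solP ps.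
  rewrite normrM (gtr0_norm p0); move: sj; have [_ <-] := ps.
  by rewrite signv_eq0 mxE normr_sg => ->; rewrite mulr1.
move/(congr1 (fun x : 'cV[R]_N => x i ord0)).
rewrite hj extend0_out ?inE ?si0 ?eqxx // subr0 mxE => /eqP.
by rewrite oner_eq0.
Qed.

End Cover.
(** * Saddle points and general position *)

Section Saddle.
Variables (R : realType) (m n : nat) (A : 'M[R]_(m, n)).

(** Along a short segment the quadratic term is of second order, so it does not
    affect the variational inequality. *)
Lemma l1_quadratic_min (lam kap : R) (g x : 'cV[R]_n) : 0 <= lam -> 0 <= kap ->
  (forall h, 0 <= - dot g h + kap * dot (A *m h) (A *m h) +
                  lam * (l1norm (x + h) - l1norm x)) <->
  l1_subgrad lam g x.
Proof.
move=> lam0 kap0; split=> [h|gx v]; last first.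
  have := dot_le_l1norm (x + v) gx.1; have := l1_subgrad_dot gx; rewrite dotDr.
  have : 0 <= kap * dot (A *m v) (A *m v) by rewrite mulr_ge0 ?dot_ge0.
  lra.
apply: l1_subgrad_VI => // w; rewrite -subr_ge0; set d := w - x.
apply: (@ge0_of_small _ 1 _ (kap * dot (A *m d) (A *m d)) ltr01) => t /andP[t0 t1].
have := h (t *: d); rewrite -scalemxAr !(dotZl, dotZr).
have : l1norm (x + t *: d) <= (1 - t) * l1norm x + t * l1norm w.
  rewrite -[t * _]l1normZ ?(ltW t0) // -l1normZ ?subr_ge0 //.
  rewrite (_ : x + t *: d = (1 - t) *: x + t *: w) ?l1normD //.
  by rewrite /d scalerBr scalerBl scale1r addrA addrAC.
move=> /(ler_wpM2l lam0) h1 h2; rewrite -(pmulr_rge0 _ t0); move: h1 h2.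
move: (l1norm _) (dot _ _) (l1norm x) (l1norm w) (dot _ _) => a b c e f; lra.
Qed.

Lemma l1_subgrad_col_mx (lam : R) (g1 g2 x1 x2 : 'cV[R]_n) :
  l1_subgrad lam (col_mx g1 g2) (col_mx x1 x2) <->
  l1_subgrad lam g1 x1 /\ l1_subgrad lam g2 x2.
Proof.
rewrite !l1_subgradP; split=> [h|[h1 h2] i]; last first.
  by rewrite -(splitK i); case: (fintype.split i) => j /=;
    rewrite ?col_mxEu ?col_mxEd; [exact: h1|exact: h2].
by split=> i; [have := h (lshift n i)|have := h (rshift n i)];
  rewrite ?col_mxEu ?col_mxEd.
Qed.

Variable rho : R.
Hypothesis rho01 : 0 <= rho < 1.

Lemma sGMC_objE b lam x z : sGMC_obj A rho b lam x z =
  2^-1 * dot (usubmx b - A *m x) (usubmx b - A *m x) + lam * l1norm x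
  - lam * l1norm z - rho / 2 * dot (A *m x - A *m z) (A *m x - A *m z)
  + Num.sqrt rho * dot (dsubmx b) (A *m z).
Proof.
rewrite /sGMC_obj !sqr_l2norm; congr (_ + _ * _).
by rewrite mxE; apply: eq_bigr => i _; rewrite mxE.
Qed.

Lemma resid_sGMC b x z :
  resid (Cmx A rho) (Dmx m rho) b (col_mx x z) =
  col_mx
    (A^T *m (usubmx b - (1 - rho) *: (A *m x) - rho *: (A *m z)))
    (A^T *m (Num.sqrt rho *: dsubmx b + rho *: (A *m x - A *m z))).
Proof.
have rr : Num.sqrt rho * Num.sqrt rho = rho.
  by rewrite -expr2 sqr_sqrtr //; case/andP: rho01.
rewrite /resid -mulmxA /Cmx /Dmx -[b in LHS]vsubmxK tr_block_mx !trmx0.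
rewrite !mul_block_col !mul0mx !addr0 !add0r -!scalemxAl.
rewrite opp_col_mx add_col_mx mul_block_col !mul0mx addr0 add0r.
rewrite !mul_scalar_mx scale1r !scalerA rr linearZ /= -scalemxAl.
rewrite (scalemxAr (Num.sqrt rho) A^T).
congr col_mx; congr mulmx; first by rewrite opprD addrA.
by rewrite scaleNr opprD opprK !scalerDr !scalerN !scalerA rr.
Qed.

(** The smooth part of the objective is a quadratic function of [x] and of
    [z], with curvature [(1 - rho) * A^T A] and [- rho * A^T A]; optimality in
    each variable is the subgradient condition of one block of the residual. *)
Lemma ext_sol_kkt p : 0 <= p.2 ->
  ext_sol A rho p.1 p.2 = [set w | kkt (Cmx A rho) (Dmx m rho) p w].
Proof.
case: p => b lam /= lam0; have /andP[r0 r1] := rho01.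
apply/seteqP.
suff H w : ext_sol A rho b lam w <-> kkt (Cmx A rho) (Dmx m rho) (b, lam) w.
  by split=> w /= /H.
rewrite /ext_sol /kkt /= -[w in resid _ _ _ w]vsubmxK -[X in l1_subgrad _ _ X]vsubmxK.
rewrite resid_sGMC l1_subgrad_col_mx.
set x := usubmx w; set z := dsubmx w.
rewrite -(@l1_quadratic_min lam ((1 - rho) / 2)) //; last first.
  by rewrite divr_ge0 // subr_ge0 ltW.
rewrite -(@l1_quadratic_min lam (rho / 2)) //; last by rewrite divr_ge0.
have dx h : sGMC_obj A rho b lam (x + h) z - sGMC_obj A rho b lam x z =
    - dot (A^T *m (usubmx b - (1 - rho) *: (A *m x) - rho *: (A *m z))) h +
    (1 - rho) / 2 * dot (A *m h) (A *m h) + lam * (l1norm (x + h) - l1norm x).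
  rewrite !sGMC_objE dot_trmx mulmxDr.
  move: (A *m x) (A *m h) (A *m z) (usubmx b) (dsubmx b) => a e c y r.
  rewrite !(dotDl, dotDr, dotNl, dotNr, dotZl, dotZr).
  rewrite (dotC a y) (dotC e y) (dotC e a) (dotC c a) (dotC c e).
  by field.
have dz h : sGMC_obj A rho b lam x z - sGMC_obj A rho b lam x (z + h) =
    - dot (A^T *m (Num.sqrt rho *: dsubmx b + rho *: (A *m x - A *m z))) h +
    rho / 2 * dot (A *m h) (A *m h) + lam * (l1norm (z + h) - l1norm z).
  rewrite !sGMC_objE dot_trmx mulmxDr.
  move: (A *m x) (A *m h) (A *m z) (usubmx b) (dsubmx b) => a e c y r.
  rewrite !(dotDl, dotDr, dotNl, dotNr, dotZl, dotZr).
  rewrite (dotC a y) (dotC e a) (dotC c a) (dotC c e).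
  by field.
split=> [H|[Hx Hz] x' z'].
  split=> h; [rewrite -dx|rewrite -dz]; rewrite subr_ge0.
    by have /andP[] := H (x + h) z.
  by have /andP[] := H x (z + h).
have := Hx (x' - x); have := Hz (z' - z); rewrite -dx -dz !(addrC _ (_ - _)) !subrK.
by rewrite !subr_ge0 => -> ->.
Qed.

(** The off-diagonal blocks of [D] are skew and cancel. *)
Lemma Dmx_pos (v : 'cV[R]_(m + m)) : (1 - rho) * dot v v <= dot v (Dmx m rho *m v).
Proof.
have /andP[r0 r1] := rho01.
rewrite -[v]vsubmxK /Dmx mul_block_col !mul_scalar_mx scale1r.
rewrite !dot_col_mx !(dotDl, dotDr, dotNl, dotNr, dotZl, dotZr).
rewrite (dotC (dsubmx v)).
have : 0 <= rho * dot (dsubmx v) (dsubmx v) by rewrite mulr_ge0 ?dot_ge0.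
lra.
Qed.

Lemma exists_kernel_vector (I : {set 'I_n}) : (m < #|I|)%N ->
  exists h : 'cV[R]_n, [/\ A *m h = 0, h != 0 & forall i, i \notin I -> h i ord0 = 0].
Proof.
move=> mI; have : kermx (colsE A I)^T != 0.
  rewrite kermx_eq0 /row_free mxrank_tr neq_ltn.
  by rewrite (leq_ltn_trans (rank_leq_row _) mI).
move=> /rowV0Pn[v vker v0]; exists (extend0 v^T); split.
- rewrite -mul_colsE; apply: trmx_inj; rewrite trmx_mul trmxK trmx0.
  exact/sub_kermxP.
- apply: contra_neq v0 => e; rewrite -[v]trmxK -[v^T]subvec_extend0 e.
  by apply/rowP => j; rewrite !mxE.
- by move=> i iI; rewrite extend0_out.
Qed.

(** If [A *m h = 0], pairing with [g] turns the linear relation between the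
    signed columns on the support of [h] into an affine one, which general
    position excludes as soon as at most [m] columns are involved; more columns
    than that carry a relation with a smaller support. *)
Lemma general_position_kernel (lam : R) (g : 'cV[R]_m) (h : 'cV[R]_n) :
  general_position A -> 0 < lam -> A *m h = 0 ->
  (forall i, h i ord0 != 0 -> `|(A^T *m g) i ord0| = lam) -> h = 0.
Proof.
move=> gp lam0; have [c] := ubnP #|supp h|; elim: c h => // c IH h hc Ah hl.
apply/eqP; apply/negPn/negP => h0.
have [i hi] : exists i, h i ord0 != 0.
  apply: contrapT => /forallNP H; move/negP: h0; apply; apply/eqP/colP => i.
  by rewrite mxE; apply/eqP; apply: contrapT => /negP; exact: H.
pose I := (supp h :\ i)%SET.
have ih : i \in supp h by rewrite inE.
have cI : (#|I| < #|supp h|)%N by rewrite [in X in (_ < X)%N](cardsD1 i) ih.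
have Im : (#|I| <= m)%N.
  rewrite leqNgt; apply/negP => /exists_kernel_vector[h' [Ah' /eqP h'0 h'I]].
  have sub : supp h' \subset I.
    by apply/fintype.subsetP => j; rewrite inE; apply: contraR => /h'I ->.
  apply: h'0; apply: IH => // [|j hj].
    by rewrite (leq_ltn_trans (subset_leq_card sub)) // (leq_trans cI).
  apply: hl; have : j \in I by apply: (fintype.subsetP sub); rewrite inE.
  by rewrite !inE => /andP[].
pose s j : R := Num.sg ((A^T *m g) j ord0).
have sP j : h j ord0 != 0 -> s j = 1 \/ s j = -1.
  move=> /hl; rewrite /s; case: (ltrgt0P ((A^T *m g) j ord0)) => H l0.
  - by left; rewrite gtr0_sg.
  - by right; rewrite ltr0_sg.
  - by move: lam0; rewrite -l0 ltxx.
have ss j : h j ord0 != 0 -> s j * s j = 1.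
  by move=> /sP[] ->; rewrite ?mulrNN mulr1.
have sg_l j : h j ord0 != 0 -> s j * (A^T *m g) j ord0 = lam.
  by move=> /hl <-; rewrite normrEsg.
have memI j : j \in I -> h j ord0 != 0 by rewrite !inE => /andP[].
apply: (gp I i s Im).
- by rewrite !inE eqxx.
- move=> j; rewrite in_setU1 => /orP[/eqP ->|/memI]; exact: sP.
pose t j := - (h j ord0 / h i ord0) * s i * s j.
have rel : s i *: col i A = \sum_(j in I) t j *: (s j *: col j A).
  have e : \sum_j h j ord0 *: col j A = 0.
    rewrite -[RHS]Ah; apply/colP => l; rewrite summxE [RHS]mxE; apply: eq_bigr => j _.
    by rewrite !mxE mulrC.
  rewrite (bigD1 i) //= (bigID (mem I)) /= [X in _ + (_ + X)]big1 in e; last first.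
    move=> j /andP[ji]; rewrite !inE ji /= negbK => /eqP ->.
    by rewrite scale0r.
  have {e} : h i ord0 *: col i A = - \sum_(j in I) h j ord0 *: col j A.
    apply/eqP; rewrite -subr_eq0 opprK; apply/eqP; rewrite -[RHS]e addr0.
    congr (_ + _); apply: eq_bigl => j; rewrite !inE.
    by case: (j == i).
  move=> /(congr1 (fun x => (s i / h i ord0) *: x)); rewrite scalerA divfK // => ->.
  rewrite scalerN -scaleNr scaler_sumr; apply: eq_bigr => j /memI hj.
  rewrite !scalerA; congr (_ *: _); rewrite /t -[RHS]mulrA ss // mulr1.
  by field.
exists t; split=> //.
have pair j : dot g (s j *: col j A) = s j * (A^T *m g) j ord0.
  rewrite dotZr; congr (_ * _); rewrite mxE.
  by apply: eq_bigr => l _; rewrite !mxE mulrC.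
have : dot g (s i *: col i A) = lam by rewrite pair sg_l.
rewrite rel (big_morph (dot g) (dotDr g) (dot0r g)).
under eq_bigr => j /memI hj do rewrite dotZr pair sg_l //.
rewrite -mulr_suml -[RHS]mul1r; apply: mulIf; exact: lt0r_neq0.
Qed.

(** The columns of the second block are those of [A] scaled by [Num.sqrt rho].
    When this scale is [0] they pair to [0] with [u], which differs from [lam]. *)
Lemma Cmx_kernel (lam : R) (u : 'cV[R]_(m + m)) (h : 'cV[R]_(n + n)) :
  general_position A -> 0 < lam -> Cmx A rho *m h = 0 ->
  (forall i, h i ord0 != 0 -> `|((Cmx A rho)^T *m u) i ord0| = lam) -> h = 0.
Proof.
move=> gp lam0; rewrite -[h]vsubmxK -[u]vsubmxK.
move: (usubmx h) (dsubmx h) (usubmx u) (dsubmx u) => h1 h2 u1 u2.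
rewrite /Cmx tr_block_mx !trmx0 !mul_block_col !mul0mx !addr0 !add0r => /eqP.
rewrite -[0]vsubmxK !linear0 => /eqP/eq_col_mx[Ah1 Ah2] hl.
have -> : h1 = 0.
  apply: (general_position_kernel (g := u1) gp lam0 Ah1) => i hi.
  by have := hl (lshift n i); rewrite !col_mxEu; apply.
suff -> : h2 = 0 by rewrite col_mx0.
apply: (general_position_kernel (g := Num.sqrt rho *: u2) gp lam0) => [|i hi].
  have [r0|r0] := eqVneq (Num.sqrt rho) 0.
    have -> : h2 = 0; last by rewrite mulmx0.
    apply/colP => i; rewrite mxE; apply/eqP; apply: contrapT => /negP hi.
    have := hl (rshift n i); rewrite !col_mxEd => /(_ hi).
    rewrite r0 scale0r trmx0 mul0mx mxE normr0 => l0.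
    by move: lam0; rewrite -l0 ltxx.
  by move/eqP: Ah2; rewrite -scalemxAl scaler_eq0 (negbTE r0) => /eqP.
have := hl (rshift n i); rewrite !col_mxEd => /(_ hi).
by rewrite linearZ /= -scalemxAl scalemxAr.
Qed.

End Saddle.
(** * The sGMC model *)

Section SGMC.
Variables (R : realType) (m n : nat) (A : 'M[R]_(m, n)) (rho : R).
Hypothesis rho01 : 0 <= rho < 1.

Local Notation C := (Cmx A rho).
Local Notation D := (Dmx m rho).
Local Notation sol := (wstar A rho).
Implicit Types (s w : 'cV[R]_(n + n)) (p q : 'cV[R]_(m + m) * R).

Lemma curvature_gt0 : 0 < 1 - rho.
Proof. by rewrite subr_gt0; case/andP: rho01. Qed.

Lemma wstarP p : 0 < p.2 -> is_min_norm [set w | kkt C D p w] (sol p).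
Proof.
move=> p0; rewrite /wstar (ext_sol_kkt A rho01 (ltW p0)).
by have := xgetPex 0 (exists_min_norm C curvature_gt0 (Dmx_pos rho01) p0).
Qed.

Lemma S_EQNQ_fits s p w : sign_vector s -> 0 <= p.2 ->
  S_EQNQ A rho s p w <-> fits C D s p w.
Proof.
move=> ss p0; have s1 i : s i ord0 != 0 -> `|s i ord0| = 1.
  by case: (ss i) => ->; rewrite ?eqxx ?normrN1 ?normr1.
have inE i : (i \in supp s) = (s i ord0 != 0) by rewrite inE.
split=> [[[eqE eqN] [nqE nqN]]|[kw ps sw]].
  have eqN' i : s i ord0 = 0 -> w i ord0 = 0.
    by move=> s0; apply: eqN; rewrite inE s0 eqxx.
  have sw i : s i ord0 * w i ord0 = `|w i ord0|.
    have [s0|s0] := eqVneq (s i ord0) 0; first by rewrite s0 mul0r eqN' ?normr0.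
    by rewrite -[LHS]ger0_norm ?nqE ?inE // normrM s1 ?mul1r.
  have ps i : s i ord0 != 0 -> resid C D p.1 w i ord0 = p.2 * s i ord0.
    by move=> s0; apply: eqE; rewrite inE.
  split=> //; apply/l1_subgradP => i; have [s0|s0] := eqVneq (s i ord0) 0.
    split; first by apply: nqN; rewrite inE s0 eqxx.
    by rewrite eqN' // normr0 !mulr0.
  by rewrite ps // -mulrA sw normrM s1 // mulr1 ger0_norm.
split; split=> i; rewrite inE => si; first exact: ps.
- by have := sw i; move/negPn/eqP: si => ->; rewrite mul0r => /esym/normr0_eq0.
- by rewrite sw.
- by have [+ _] := kw; apply.
Qed.

Lemma I_EN_fits s p : sign_vector s ->
  I_EN A rho s p <-> 0 < p.2 /\ fits C D s p (eq_fit C D s p).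
Proof.
move=> ss; split=> -[p0 H]; split=> //; have := ltW p0; move=> p0'.
  exact/(S_EQNQ_fits _ ss p0').
exact/(S_EQNQ_fits _ ss p0').
Qed.

Section GeneralPosition.
Hypothesis gp : general_position A.

(** Two solutions differ by a null vector of [C] whose support only contains
    indices that attain [lam]. *)
Lemma kkt_unique p w v : 0 < p.2 -> kkt C D p w -> kkt C D p v -> w = v.
Proof.
move=> p0 kw kv; have Cwv := kkt_eqC curvature_gt0 (Dmx_pos rho01) kw kv.
apply/eqP; rewrite -subr_eq0; apply/eqP.
apply: (Cmx_kernel (rho := rho) (u := p.1 - D *m C *m w) gp p0).
  by rewrite mulmxBr Cwv subrr.
have attain x i : kkt C D p x -> x i ord0 != 0 -> `|resid C D p.1 x i ord0| = p.2.
  move=> kx xi; have [_ /(_ i) + _] := kkt_fits kx; rewrite signv_eq0 => -> //.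
  by rewrite normrM (gtr0_norm p0) mxE normr_sg xi mulr1.
move=> i wvi; rewrite -/(resid C D p.1 w).
have [w0|w0] := eqVneq (w i ord0) 0; last exact: attain.
rewrite (resid_eqC _ _ Cwv); apply: attain => //.
by apply: contra_neq wvi => v0; rewrite !mxE w0 v0 subr0.
Qed.

Lemma ext_sol_fits s p : sign_vector s -> 0 < p.2 -> fits C D s p (sol p) ->
  ext_sol A rho p.1 p.2 = S_EQNQ A rho s p.
Proof.
move=> ss p0 fp; rewrite (ext_sol_kkt A rho01 (ltW p0)); apply/seteqP; split=> w.
  have [kp _] := wstarP p0; move=> /= kw; rewrite (kkt_unique p0 kw kp).
  by apply/S_EQNQ_fits => //; exact: ltW.
by move/(S_EQNQ_fits w ss (ltW p0)) => -[].
Qed.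

(** A point of [I_EN] plus an interior point of the cell lies in the cell by
    [fits_add_cell]; halving the latter leaves room to stay in its interior. *)
Lemma I_EN_zone s : sign_vector s -> (cell sol s)° !=set0 ->
  closure (cell sol s)° `&` @param_dom R (m + m) = I_EN A rho s.
Proof.
move=> ss s0; have k0 := curvature_gt0; have Dp := Dmx_pos (m := m) rho01.
have JD := @cell_add R _ _ C D _ k0 Dp sol wstarP s.
have JZ := @cellZ R _ _ C D _ k0 Dp sol wstarP s.
apply/seteqP; split=> p.
  move=> sp; apply/I_EN_fits => //; have [_ p0] := sp; split=> //.
  by have [] := zone_fits k0 Dp wstarP s0 sp.
move/(I_EN_fits p ss) => [p0 fp]; apply/(zoneP k0 Dp wstarP _ s0); split=> // q sq.
have half : 0 < (2^-1 : R) by rewrite invr_gt0.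
have -> : p + q = (p + 2^-1 *: q) + 2^-1 *: q.
  by rewrite -addrA -scalerDl -[2^-1]div1r -splitr scale1r.
have sq2 := cone_interiorZ JZ half sq.
apply: (cone_interiorD JD) => //.
apply: (fits_add_cell wstarP _ p0 fp (interior_subset sq2)).
by move=> p' w' v'; exact: kkt_unique.
Qed.

Lemma csign_open_cell s p : (cell sol s)° p -> csign A rho p = s.
Proof.
move=> sp; have ps := interior_subset sp; have [p0 sE] := ps.
have [kp _] := wstarP p0.
have xE : xget 0 (ext_sol A rho p.1 p.2) = sol p.
  apply: (kkt_unique p0) => //; rewrite (ext_sol_kkt A rho01 (ltW p0)).
  by have := xgetPex 0 (ex_intro _ _ kp).
apply/colP => i; rewrite mxE xE -[xi _ _ _ _]/(resid C D p.1 (sol p)).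
have [s0|s0] := eqVneq (s i ord0) 0.
  have off := strict_off_support curvature_gt0 (Dmx_pos rho01) wstarP _ sp s0.
  rewrite s0 (negbTE (off _)) //.
  by move=> h Ch hl; exact: (Cmx_kernel gp p0 Ch hl).
have [_ /(_ i s0) -> _] := cell_fits wstarP ps.
move: s0; rewrite -{}sE signv_eq0 mxE => w0.
rewrite normrM (gtr0_norm p0) normr_sg w0 mulr1 eqxx.
by rewrite sgrM (gtr0_sg p0) mul1r sgr_id.
Qed.

End GeneralPosition.
End SGMC.

Unset Implicit Arguments.

Theorem theorem3 (R : realType) (m n : nat) (A : 'M[R]_(m, n)) (rho : R)
    (hm : (0 < m)%N) (hn : (0 < n)%N) (hrho : 0 <= rho < 1) :
  let w := wstar A rho in
  let zone := linear_zones w in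
  (* (a) *)
  [/\ piecewise_linear w,
      (zone #<= `I_(3 ^ (2 * n)))%card &
      forall Z, zone Z -> forall p q, interior Z p -> interior Z q ->
        signv (w p) = signv (w q)] /\
  (* (b) *)
  [/\ forall Z, zone Z -> exists! s, zone_indicator w Z s,
      forall Z1 Z2 s, zone Z1 -> zone Z2 ->
        zone_indicator w Z1 s -> zone_indicator w Z2 s -> Z1 = Z2 &
      forall Z s, zone Z -> zone_indicator w Z s ->
        [/\ convex_cone Z, Z `<=` I_EN A rho s &
            forall p, Z p -> w p = w_EQ A rho s p]] /\
  (* (c) *)
  (general_position A ->
   forall Z s, zone Z -> zone_indicator w Z s ->
     [/\ Z = I_EN A rho s,
         forall p, Z p ->
           w p = w_EQ A rho s p /\ ext_sol A rho p.1 p.2 = S_EQNQ A rho s p &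
         forall p, interior (I_EN A rho s) p ->
           s = signv (w p) /\ signv (w p) = csign A rho p]).
Proof.
move=> w zone; have k0 := curvature_gt0 hrho; have Dp := Dmx_pos (m := m) hrho.
have wP := wstarP A hrho.
have zP := linear_zonesP k0 Dp wP.
have iP s s' (s0 : (cell w s)° !=set0) := zone_indicatorP k0 Dp wP s' s0.
have fP s p (s0 : (cell w s)° !=set0) := zone_fits k0 Dp wP s0 (p := p).
have intP s (s0 : (cell w s)° !=set0) := interior_zone k0 Dp wP s0.
split; last split.
- have wL := sol_piecewise_linear k0 Dp wP; have zB := linear_zones_bound k0 Dp wP.
  split=> //; first by rewrite mul2n -addnn.
  move=> Z /zP[s s0 ->] p q; rewrite (intP s s0).
  by move=> /interior_subset[_ ->] /interior_subset[_ ->].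
- split.
  + move=> Z /zP[s s0 ->]; exists s; split; first exact/iP.
    by move=> s' /(iP s s' s0).
  + move=> Z1 Z2 s /zP[s1 s10 ->] /zP[s2 s20 ->].
    by move=> /(iP _ _ s10) -> /(iP _ _ s20) ->.
  + move=> Z s /zP[s' s0 ->] sZ; have [ss _] := sZ; have e := (iP _ _ s0).1 sZ.
    rewrite {}e in ss sZ *; split.
    * by have := zone_convex_cone k0 Dp wP s0.
    * move=> p sp; apply/(I_EN_fits A rho p ss); have [_ p0] := sp; split=> //.
      by have [] := fP s' p s0 sp.
    * by move=> p /(fP s' p s0)[].
- move=> gp Z s /zP[s' s0 ->] sZ; have [ss _] := sZ; have e := (iP _ _ s0).1 sZ.
  rewrite {}e in ss sZ *; have IE := I_EN_zone hrho gp ss s0; split=> //.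
    move=> p sp; have [fw wE] := fP s' p s0 sp; split=> //.
    by apply: ext_sol_fits => //; [case: sp|rewrite wE].
  move=> p; rewrite -IE (intP s' s0) => sp; have [_ sE] := interior_subset sp.
  by rewrite -/w sE (csign_open_cell hrho gp sp).
Qed.
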